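(* Let $\Gamma$ be a crystallographic group of rank at least $2$ which does not contain a normal infinite cyclic subgroup, with associated short exact sequence $1 \to A \to \Gamma \xrightarrow{pr} F \to 1$. Let $\mathcal{F}$ be the family of all subgroups $H \leq \Gamma$ whose virtual cohomological dimension is smaller than that of $\Gamma$ or which do not surject onto $F$ under $pr$ (i.e. $pr(H) \neq F$). Then, for every finite symmetric generating set $S$ of $\Gamma$, the pair $(\Gamma,S)$ is a Dress--Farrell--Hsiang group of bounded depth with respect to $\mathcal{F}$.
   Context: A group $\Gamma$ is crystallographic if it contains a normal, finitely generated free abelian subgroup $A$ of finite index which equals its own centraliser in $\Gamma$. The subgroup $A$ is unique; the rank of $\Gamma$ is the rank of $A$ and equals the virtual cohomological dimension of $\Gamma$. Set $F := \Gamma/A$ (a finite group) and let $pr \colon \Gamma \to F$ be the projection. A $G$-simplicial complex is an (abstract) simplicial complex $X$ with a simplicial $G$-action such that whenever $g \in G$ fixes a simplex $\{x_0,\dots,x_n\}$ of $X$ (as a set), then $g x_i = x_i$ for all $i$. Points and metrics of such a complex refer to its geometric realisation; the $\ell^1$-metric is $d^{\ell^1}(\sum_v \lambda_v v, \sum_v \mu_v v) = \sum_v |\lambda_v - \mu_v|$ in barycentric coordinates. A map from the discrete set $G$ to a complex means a map into its geometric realisation. The class $\mathcal{D}r$ (Dress family) consists of the finite groups $D$ for which there are primes $p$ and $q$ and a normal series $P \unlhd H \unlhd D$ such that $P$ is a finite $p$-group, $H/P$ is a finite cyclic group and $D/H$ is a finite $q$-group. The depth $d(Q)$ of a finite group $Q$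 is the largest $n$ such that there is a chain of subgroups $Q_1 \supsetneq Q_2 \supsetneq \dots \supsetneq Q_n$ in $Q$. Let $G$ be a group, $S$ a finite symmetric generating set of $G$ and $\mathcal{F}$ a family of subgroups of $G$ (closed under conjugation and taking subgroups). $(G,S)$ is a Dress--Farrell--Hsiang group of bounded depth with respect to $\mathcal{F}$ if there exist $N \in \mathbb{N}$ and $B \in \mathbb{N}$ such that for every $\epsilon > 0$ there are (i) an epimorphism $\pi \colon G \twoheadrightarrow Q$ onto a finite group with $d(Q) \leq B$, and (ii) for every subgroup $D \leq Q$ with $D \in \mathcal{D}r$, a $G$-simplicial complex $E_D$ of dimension at most $N$ whose isotropy groups lie in $\mathcal{F}$, and a $\overline{D} := \pi^{-1}(D)$-equivariant map $f_D \colon G \to E_D$ (where $\overline{D}$ acts on $G$ by left multiplication) such that $d^{\ell^1}(f_D(g),f_D(g')) \leq \epsilon$ whenever $g,g' \in G$ satisfy $g^{-1}g' \in S$. *)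

(* Defs.v *)
From HB Require Import structures.
From mathcomp Require Import all_boot all_order all_algebra all_fingroup all_solvable.
From mathcomp Require Import all_classical all_reals.

Set Implicit Arguments.
Unset Strict Implicit.
Unset Printing Implicit Defensive.

Import Order.TTheory GRing.Theory Num.Theory.

Local Open Scope classical_set_scope.
Local Open Scope group_scope.

Section Subgroups.
Variable G : groupType.
Implicit Types (H K X : set G).

Definition subgroup H : Prop := H 1 /\ forall x y, H x -> H y -> H (x * y^-1).

Definition normal_subgroup H : Prop :=
  subgroup H /\ forall g h, H h -> H (h ^ g).

Definition generated X : set G :=
  [set g | forall H, subgroup H -> X `<=` H -> H g].

Definition infinite_cyclic H : Prop :=
  (exists c, H = generated [set c]) /\ infinite_set H.

Definition centraliser X : set G := [set g | forall x, X x -> commute g x].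

(* Finitely many left cosets of K cover H; meant for K `<=` H. *)
Definition finite_index K H : Prop :=
  exists s : seq G, forall h, H h -> exists2 x, x \in s & K (x^-1 * h).

Definition torsion_free : Prop :=
  forall (x : G) (n : nat), (0 < n)%N -> x ^+ n = 1 -> x = 1.

Definition free_abelian_of_rank H (n : nat) : Prop :=
  exists phi : 'rV[int]_n -> G,
    [/\ forall u v, phi (u + v)%R = phi u * phi v, injective phi & range phi = H].

(* [G] is crystallographic when some [A] is such a subgroup; [A] is unique. *)
Definition crystallographic_with (A : set G) : Prop :=
  [/\ normal_subgroup A,
      exists n, free_abelian_of_rank A n,
      finite_index A [set: G]
    & centraliser A = A].

Definition finite_symmetric_generating (S : set G) : Prop :=
  [/\ finite_set S, forall s, S s -> S s^-1 & generated S = [set: G]].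

Definition subgroup_family (Fam : set (set G)) : Prop :=
  [/\ forall H, Fam H -> subgroup H,
      forall H g, Fam H -> Fam [set h ^ g | h in H]
    & forall H K, Fam H -> subgroup K -> K `<=` H -> Fam K].

End Subgroups.

(* Modules over the integral group ring of T: abelian groups with an action
   of T by additive maps. *)
Record gmodule (T : groupType) := GModule {
  gm_carrier :> zmodType;
  gm_act : T -> {additive gm_carrier -> gm_carrier};
  gm_act1 : forall x, gm_act 1 x = x;
  gm_actM : forall s t x, gm_act (s * t) x = gm_act s (gm_act t x)
}.

Section CohomologicalDimension.
Variable T : groupType.

Definition equivariant (M N : gmodule T) (f : M -> N) : Prop :=
  forall t x, f (gm_act M t x) = gm_act N t (f x).

Definition projective (P : gmodule T) : Prop :=
  forall (M N : gmodule T) (p : {additive M -> N}) (f : {additive P -> N}),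
    equivariant p -> range p = [set: N] -> equivariant f ->
    exists2 g : {additive P -> M}, equivariant g & forall x, p (g x) = f x.

Definition trivial_int : gmodule T :=
  @GModule T int (fun=> idfun) (fun=> erefl) (fun _ _ _ => erefl).

(* A projective resolution ... -> P 1 -> P 0 -> Z -> 0 of length at most n. *)
Definition cd_le (n : nat) : Prop :=
  exists (P : nat -> gmodule T) (d : forall k, {additive P k.+1 -> P k})
         (e : {additive P 0 -> trivial_int}),
    [/\ (forall k, projective (P k)) /\ (forall k, equivariant (d k)),
        equivariant e /\ range e = setT,
        e @^-1` [set 0%R] = range (d 0),
        forall k, d k @^-1` [set 0%R] = range (d k.+1)
      & forall k, (n < k)%N -> forall x : P k, x = 0%R].

Definition cd_eq (n : nat) : Prop :=
  cd_le n /\ forall m, cd_le m -> (n <= m)%N.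

End CohomologicalDimension.

(* vcd H = n for a subgroup H of G. The torsion-free subgroup of finite index
   in H is given as the image of an injective homomorphism; by Serre's theorem
   its cohomological dimension does not depend on its choice. *)
Definition vcd_eq (G : groupType) (H : set G) (n : nat) : Prop :=
  exists (T : groupType) (i : {multiplicative T -> G}),
    [/\ injective i, range i `<=` H, finite_index (range i) H,
        torsion_free T & cd_eq T n].

Definition vcd_lt (G : groupType) (H K : set G) : Prop :=
  exists m n, [/\ vcd_eq H m, vcd_eq K n & (m < n)%N].

Definition small_subgroups (G : groupType) (F : finGroupType)
    (pr : {multiplicative G -> F}) : set (set G) :=
  [set H | subgroup H /\ (vcd_lt H [set: G] \/ pr @` H <> [set: F])].

Definition is_dress (gT : finGroupType) (D : {group gT}) : Prop :=
  exists p q : nat, prime p /\ prime q /\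
    exists P H : {group gT},
      [/\ (P <| H)%g, (H <| D)%g, p.-group P, cyclic (H / P) & q.-group (D / H)].

(* A strict chain has at most as many terms as there are subgroups. *)
Definition depth (Q : finGroupType) : nat :=
  \max_(n < #|{: {group Q}}|.+1 |
        [exists s : n.-tuple {group Q},
           sorted (fun H K : {group Q} => K \proper H) s]) n.

Record gcomplex (G : groupType) := GComplex {
  vertex :> choiceType;
  simplex : set (set vertex);
  vact : G -> vertex -> vertex;
  simplex_finite : forall s, simplex s -> finite_set s;
  simplex_nonempty : forall s, simplex s -> s !=set0;
  simplex_sub : forall s t, simplex s -> t `<=` s -> t !=set0 -> simplex t;
  simplex_vertex : forall v, simplex [set v];
  vact1 : forall v, vact 1 v = v;
  vactM : forall g h v, vact (g * h) v = vact g (vact h v);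
  vact_simplex : forall g s, simplex s -> simplex (vact g @` s);
  vact_fix : forall g s, simplex s -> vact g @` s = s ->
    forall v, s v -> vact g v = v
}.

Section Realisation.
Variables (R : realType) (G : groupType) (E : gcomplex G).

Definition dim_le (N : nat) : Prop :=
  forall s, @simplex G E s -> (s #<= `I_N.+1)%card.

(* Points are given by their barycentric coordinates. *)
Definition realisation : set (E -> R) :=
  [set x | [/\ forall v, (0 <= x v)%R,
               simplex [set v | x v != 0%R]
             & (\sum_(v \in [set: E]) x v = 1)%R]].

Definition pact (g : G) (x : E -> R) : E -> R := fun v => x (vact g^-1 v).

Definition isotropy (x : E -> R) : set G := [set g | pact g x = x].

Definition l1dist (x y : E -> R) : R := (\sum_(v \in [set: E]) `|x v - y v|)%R.

End Realisation.

Definition dress_farrell_hsiang (R : realType) (G : groupType)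
    (S : set G) (Fam : set (set G)) : Prop :=
  [/\ finite_symmetric_generating S, subgroup_family Fam &
  exists N B : nat, forall eps : R, (0 < eps)%R ->
  exists (Q : finGroupType) (p : {multiplicative G -> Q}),
    [/\ range p = [set: Q], (depth Q <= B)%N &
    forall D : {group Q}, is_dress D ->
    exists (E : gcomplex G) (f : G -> E -> R),
      [/\ dim_le E N,
          forall x : E -> R, realisation x -> Fam (isotropy x),
          forall g, realisation (f g),
          forall d g, p d \in D -> f (d * g) = pact d (f g)
        & forall g g', S (g^-1 * g') -> (l1dist (f g) (f g') <= eps)%R]]].

(* Main.v *)
Require Import Defs.
From HB Require Import structures.
From mathcomp Require Import all_boot all_order all_algebra all_fingroup all_solvable.
From mathcomp Require Import all_classical all_reals.
From mathcomp Require Import zify ring.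

(** Let [phi] identify [Z^n] with [A], and let [Q] be the quotient of [Gamma] by
    [s A], where [s] is a product of [3 #|F|] primes, all larger than a bound
    that depends on [eps]. The number of prime factors of
    [#|Q| = #|F| * s ^ n], counted with multiplicity, does not depend on [eps],
    and it bounds the depth of [Q] ([depth_le_Omega]).

    Let [D] be a Dress subgroup of [Q] and [Dbar] its preimage in [Gamma]. If
    [Dbar] does not surject onto [F], a constant map to the discrete
    [Gamma]-set of nontrivial subsets of [F] is as required
    ([proper_image_complex]).

    If it does, the intersection of [Dbar] and [A] lies in [l A] for one of the
    primes [l] ([dress_lattice_divisible]). Indeed, let [P <| H <| D] exhibit
    [D] as a Dress group for the primes [p] and [q], with [l] different from
    both. The elements of [D] of order [l] that come from [A] form a cyclic
    group, since it embeds into the cyclic group [H / P], and [D] acts on it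
    through the [q]-group [D / H]. When [l] is not [1] modulo [2 q], a
    [q]-group acts on a group of order [l] by signs only ([dress_signs]). If
    the cyclic group were nontrivial, there would be a vector [w] of [Z^n],
    not divisible by [l], with [g w] congruent to [w] or [- w] modulo [l] for
    every [g]; the sum of the vectors [f w] over [f] in [F], weighted by these
    signs, would be a nonzero vector of [Z^n] that every [g] fixes or negates,
    and it would span a normal infinite cyclic subgroup ([signs_give_line]).
    Euclid's argument provides the primes ([prime_supply]).

    An inclusion of [Dbar /\ A] in [l A] makes it possible to contract by the
    factor [l] ([contracting_complex]). The functions [W : Gamma -> Z^n] with
    [W (x * phi u) = W x - u] are determined by their values on representatives
    of the cosets of [A], so they form a lattice of rank [n #|F|], on which
    [Gamma] acts by translations composed with permutations of the
    coordinates. Such maps preserve the coordinatewise order. Hence they act on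
    the triangulation whose simplices are the chains of vectors with
    differences in [{0, l}^(n #|F|)], and an element that preserves a finite
    chain fixes all its members. The group [Gamma] itself maps
    equivariantly to this lattice. The vectors in one residue class modulo [l]
    triangulate the whole real space, and the inclusion of [Dbar /\ A] in
    [l A] is what allows to choose a residue class preserved by [Dbar]
    ([residue_exists]). A point is then expressed in barycentric coordinates as
    the distribution of the vectors obtained by rounding it down to the residue
    class after adding a uniformly random [k < l] to all coordinates. If a
    coordinate moves by [C], its rounding changes for at most [C] of the [l]
    values of [k], by Hermite's identity ([floor_change_count]), so that the
    l1-distance of the images of neighbours is of order [1 / l].

    The isotropy groups of this triangulation meet [A] trivially, so they are
    finite and their virtual cohomological dimension is [0]. That of [Gamma] is
    positive: there is a resolution of finite length over [Z^n], an iterated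
    mapping cone ([cd_le_prod_int]), and [Z] is not projective over a group
    that maps nontrivially to [Z] ([cd_le0_no_hom]). The family is closed under
    subgroups because projective modules remain projective over a subgroup
    ([projective_restrict]). *)

Set Implicit Arguments.
Unset Strict Implicit.
Unset Printing Implicit Defensive.

Import Order.TTheory GRing.Theory Num.Theory.

Local Open Scope classical_set_scope.
Local Open Scope group_scope.

(** * Restriction of projective modules to a subgroup *)

Section Homomorphisms.
Variables (G H : groupType) (f : {multiplicative G -> H}).

Lemma hom1 : f 1 = 1.
Proof. by apply: (mulgI (f 1)); rewrite -gmulfM !mulg1. Qed.

Lemma homV x : f x^-1 = (f x)^-1.
Proof. by apply: (mulgI (f x)); rewrite -gmulfM !mulgV hom1. Qed.

End Homomorphisms.

Section Restriction.
Variables (K T : groupType) (j : {multiplicative K -> T}).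

Definition restrict_scalars (M : gmodule T) : gmodule K.
Proof.
exists M (fun k => gm_act M (j k)) => [x | s t x].
- by rewrite hom1 gm_act1.
- by rewrite gmulfM gm_actM.
Defined.

Section Coinduction.
Variable M : gmodule K.

(** Coinduction is right adjoint to restriction; it is exact since [T] is a
    disjoint union of right cosets of the image of [K]. *)
Definition coind_pred : {pred T -> M} :=
  fun h => `[< forall k t, h (j k * t) = gm_act M k (h t) >].

Lemma coind_zmod_closed : zmod_closed coind_pred.
Proof.
split=> [|f g /asboolP fP /asboolP gP]; apply/asboolP => k t.
- by rewrite /= raddf0.
- by rewrite !fctE fP gP raddfB.
Qed.

Record coind := Coind { coind_fun :> T -> M; coindP : coind_pred coind_fun }.

HB.instance Definition _ := [isSub for coind_fun].
HB.instance Definition _ := [Choice of coind by <:].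
HB.instance Definition _ :=
  GRing.SubChoice_isSubZmodule.Build _ _ coind coind_zmod_closed.

Lemma coindE (h : coind) k t : h (j k * t) = gm_act M k (h t).
Proof. by have /asboolP := coindP h. Qed.

Lemma coind_translate_subproof (s : T) (h : coind) :
  coind_pred (fun t => h (t * s)).
Proof. by apply/asboolP => k t; rewrite -mulgA coindE. Qed.

Definition coind_translate s h := Coind (coind_translate_subproof s h).

Lemma coind_translate_is_zmod_morphism s : zmod_morphism (coind_translate s).
Proof. by move=> f g; apply/val_inj. Qed.

HB.instance Definition _ s := GRing.isZmodMorphism.Build coind coind
  (coind_translate s) (coind_translate_is_zmod_morphism s).

Definition coind_module : gmodule T.
Proof.
exists coind (fun s => coind_translate s) => [h | s t h];
  apply/val_inj/funext => x /=.
- by rewrite mulg1.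
- by rewrite mulgA.
Defined.

End Coinduction.

Section CoindMap.
Variables (M N : gmodule K) (p : {additive M -> N}) (p_eq : equivariant p).

Lemma coind_map_subproof (h : coind M) : coind_pred (fun t => p (h t)).
Proof. by apply/asboolP => k t; rewrite coindE p_eq. Qed.

Definition coind_map h := Coind (coind_map_subproof h).

Lemma coind_map_is_zmod_morphism : zmod_morphism coind_map.
Proof. by move=> f g; apply/val_inj/funext => t /=; rewrite raddfB. Qed.

HB.instance Definition _ := GRing.isZmodMorphism.Build (coind M) (coind N)
  coind_map coind_map_is_zmod_morphism.

(** A lift is chosen freely on one representative [r t] of each right coset, and
    extended to the coset by equivariance; [kap t] is the element of [K] that
    moves the representative to [t]. *)
Lemma coind_map_surj : injective j -> range p = setT -> range coind_map = setT.
Proof.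
move=> j_inj p_surj; rewrite -subTset => h _.
have /choice[m mP] : forall y, exists x, p x = y.
  move=> y; have [x _ <-] : range p y by rewrite p_surj.
  by exists x.
pose inc t x := `[< exists k, t = j k * x >].
have inc_refl t : inc t t by apply/asboolP; exists 1; rewrite hom1 mul1g.
pose r t := choose (inc t) t.
have /choice[kap kapP] : forall t, exists k, t = j k * r t.
  by move=> t; have /asboolP := chooseP (inc_refl t).
have r_mul k t : r (j k * t) = r t.
  have E : inc (j k * t) =1 inc t.
    move=> x; apply/asboolP/asboolP => [[k' e]|[k' ->]].
      exists (k^-1 * k'); rewrite gmulfM homV -mulgA -e.
      by rewrite mulKg.
    by exists (k * k'); rewrite gmulfM mulgA.
  rewrite /r (eq_choose E) (@choose_id _ (inc t) _ t) //.
  by rewrite -E.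
have kap_mul k t : kap (j k * t) = k * kap t.
  apply: j_inj; apply: (@mulIg _ (r t)).
  by rewrite -[in LHS](r_mul k) -kapP gmulfM -mulgA -kapP.
have phiP : coind_pred (fun t => gm_act M (kap t) (m (h (r t)))).
  by apply/asboolP => k t; rewrite r_mul kap_mul gm_actM.
exists (Coind phiP) => //; apply/val_inj/funext => t /=.
by rewrite p_eq mP -coindE -kapP.
Qed.

End CoindMap.

(** A lifting problem over [K] becomes, by adjunction, a lifting problem over [T]
    for the coinduced modules; evaluation at [1] translates a solution back. *)
Lemma projective_restrict (P : gmodule T) :
  injective j -> projective P -> projective (restrict_scalars P).
Proof.
move=> j_inj P_proj M N p f p_eq p_surj f_eq.
have F_sub (x : P) : coind_pred (fun t => f (gm_act P t x)).
  by apply/asboolP => k t; rewrite gm_actM (f_eq k).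
pose F (x : P) : coind_module N := Coind (F_sub x).
have F_add : zmod_morphism F.
  by move=> x y; apply/val_inj/funext => t /=; rewrite !raddfB.
pose FA : {additive P -> coind_module N} := HB.pack F
  (GRing.isZmodMorphism.Build _ _ F F_add).
have FA_eq : equivariant FA.
  by move=> t x; apply/val_inj/funext => s /=; rewrite gm_actM.
pose CP : {additive coind_module M -> coind_module N} := coind_map p_eq.
have CP_eq : equivariant CP by move=> t x; apply/val_inj/funext.
have [g g_eq gP] := P_proj _ _ CP FA CP_eq (coind_map_surj p_eq j_inj p_surj) FA_eq.
pose g1 (x : restrict_scalars P) : M := (g x : coind M) 1.
have g1_add : zmod_morphism g1 by move=> x y; rewrite /g1 raddfB.
pose g1A : {additive restrict_scalars P -> M} := HB.pack g1
  (GRing.isZmodMorphism.Build _ _ g1 g1_add).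
exists g1A => [k x | x] /=.
  have := g_eq (j k) x => /(congr1 (fun h : coind M => h 1)) /= E.
  by rewrite /g1A /= /g1 E mul1g -[j k]mulg1 coindE.
have := gP x => /(congr1 (fun h : coind N => h 1)) /= ->.
by rewrite gm_act1.
Qed.

Lemma cd_le_restrict m : injective j -> cd_le T m -> cd_le K m.
Proof.
move=> j_inj [P [d [e [[P_proj d_eq] [e_eq e_surj] ex0 ex P0]]]].
exists (fun k => restrict_scalars (P k)), d, e; split=> //.
- by split=> k; [apply: projective_restrict | move=> t x; rewrite -(d_eq k)].
- by split=> // t x; have := e_eq (j t) x.
Qed.

End Restriction.

(** * Finitely supported functions on the integers *)

Section FiniteSupport.
Local Open Scope ring_scope.

Section Module.
Variable M : zmodType.

Definition finsupp_pred : {pred int -> M} :=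
  fun f => `[< exists r : seq int, forall i, i \notin r -> f i = 0 >].

Lemma finsupp_zmod_closed : zmod_closed finsupp_pred.
Proof.
split=> [|f g /asboolP[r fr] /asboolP[s gs]]; apply/asboolP; first by exists [::].
exists (r ++ s) => i; rewrite mem_cat negb_or => /andP[ir js].
by rewrite !fctE fr ?gs ?subr0.
Qed.

Record finsupp := Finsupp {
  finsupp_fun :> int -> M; finsuppP : finsupp_pred finsupp_fun }.

HB.instance Definition _ := [isSub for finsupp_fun].
HB.instance Definition _ := [Choice of finsupp by <:].
HB.instance Definition _ :=
  GRing.SubChoice_isSubZmodule.Build _ _ finsupp finsupp_zmod_closed.

Lemma finsupp_ext (f g : finsupp) : f =1 g -> f = g.
Proof. by move=> fg; apply/val_inj/funext. Qed.

Lemma finsuppE (f : finsupp) :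
  exists r : seq int, uniq r /\ forall i, i \notin r -> f i = 0.
Proof.
have /asboolP[r fr] := finsuppP f; exists (undup r); split; first exact: undup_uniq.
by move=> i; rewrite mem_undup; apply: fr.
Qed.

Lemma monomial_subproof (i : int) (x : M) :
  finsupp_pred (fun k => if k == i then x else 0).
Proof. by apply/asboolP; exists [:: i] => k; rewrite inE => /negPf ->. Qed.

Definition monomial i x : finsupp := Finsupp (monomial_subproof i x).

Lemma monomial_is_zmod_morphism i : zmod_morphism (monomial i).
Proof.
move=> x y; apply: finsupp_ext => k; rewrite /= !fctE /=.
by case: eqP => // _; rewrite subr0.
Qed.

HB.instance Definition _ i := GRing.isZmodMorphism.Build M finsupp
  (monomial i) (monomial_is_zmod_morphism i).

(** A finitely supported function is the sum of its monomials; this reduces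
    identities between additive maps to monomials, see [finsupp_morph_eq]. *)
Lemma finsupp_ind (P : finsupp -> Prop) :
    P 0 -> (forall i x f, P f -> P (monomial i x + f)) ->
  forall f, P f.
Proof.
move=> P0 PD f; have [r [r_uniq fr]] := finsuppE f.
suff -> : f = \sum_(i <- r) monomial i (f i).
  by elim: (r) => [|i s IHs]; rewrite ?big_nil // big_cons; apply: PD.
apply: finsupp_ext => k; have ev (s : seq int) :
    (\sum_(i <- s) monomial i (f i) : finsupp) k
      = \sum_(i <- s) (if k == i then f i else 0).
  by elim: s => [|i s IHs]; rewrite ?big_nil // !big_cons -IHs.
rewrite ev -big_mkcond /=; have [kr|kr] := boolP (k \in r).
  by rewrite (big_rem k) //= eqxx big_seq_cond big1 ?addr0 // => i /andP[];
    rewrite mem_rem_uniq // !inE => /andP[/negP ik _] /eqP e; case: ik; apply/eqP.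
rewrite fr // big_seq_cond big1 // => i /andP[ir /eqP ki].
by rewrite ki ir in kr.
Qed.

End Module.

Section Fold.
Variables (M W : zmodType) (g : int -> {additive M -> W}).

Definition finsupp_fold (f : finsupp M) : W := \sum_(i \in [set: int]) g i (f i).

Lemma finsupp_fold_seq (f : finsupp M) (r : seq int) : uniq r ->
  (forall i, i \notin r -> f i = 0) -> finsupp_fold f = \sum_(i <- r) g i (f i).
Proof.
move=> r_uniq fr; rewrite /finsupp_fold (fsbigE r) //.
  by apply: eq_bigl => i; rewrite in_setT.
by move=> i _ /fr ->; rewrite raddf0.
Qed.

Lemma finsupp_fold_is_zmod_morphism : zmod_morphism finsupp_fold.
Proof.
move=> f h; have [r [_ fr]] := finsuppE f; have [s [_ hs]] := finsuppE h.
pose q := undup (r ++ s).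
have fq i : i \notin q -> f i = 0.
  by rewrite mem_undup mem_cat negb_or => /andP[/fr].
have hq i : i \notin q -> h i = 0.
  by rewrite mem_undup mem_cat negb_or => /andP[_ /hs].
rewrite !(@finsupp_fold_seq _ q) ?undup_uniq // -?sumrB.
  by apply: eq_bigr => i _; rewrite -raddfB.
by move=> i iq; rewrite /= !fctE fq ?hq ?subr0.
Qed.

HB.instance Definition _ := GRing.isZmodMorphism.Build (finsupp M) W
  finsupp_fold finsupp_fold_is_zmod_morphism.

Lemma finsupp_fold_monomial i x : finsupp_fold (monomial i x) = g i x.
Proof.
rewrite (@finsupp_fold_seq _ [:: i]) ?big_seq1 /= ?eqxx // => k.
by rewrite inE => /negPf ->.
Qed.

End Fold.

Lemma finsupp_morph_eq (M W : zmodType) (f g : {additive finsupp M -> W}) :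
  (forall i x, f (monomial i x) = g (monomial i x)) -> f =1 g.
Proof.
move=> fg; elim/finsupp_ind => [|i x h IHh]; first by rewrite !raddf0.
by rewrite !raddfD fg IHh.
Qed.

Section Map.
Variables (M N : zmodType) (p : {additive M -> N}).

Lemma fs_map_subproof (f : finsupp M) : finsupp_pred (fun i => p (f i)).
Proof.
have [r [_ fr]] := finsuppE f.
by apply/asboolP; exists r => i /fr ->; rewrite raddf0.
Qed.

Definition fs_map f : finsupp N := Finsupp (fs_map_subproof f).

Lemma fs_map_is_zmod_morphism : zmod_morphism fs_map.
Proof. by move=> f g; apply: finsupp_ext => i /=; rewrite raddfB. Qed.

HB.instance Definition _ := GRing.isZmodMorphism.Build (finsupp M) (finsupp N)
  fs_map fs_map_is_zmod_morphism.

Lemma fs_map_monomial i x : fs_map (monomial i x) = monomial i (p x).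
Proof. by apply: finsupp_ext => k /=; case: eqP => // _; rewrite raddf0. Qed.

End Map.

Lemma fs_map_exact (M N W : zmodType) (p : {additive M -> N})
    (q : {additive N -> W}) :
    q @^-1` [set 0] = range p -> fs_map q @^-1` [set 0] = range (fs_map p).
Proof.
move=> ex; apply/seteqP; split=> [f /= qf0|_ [f _ <-]] /=.
  have /choice[h hP] : forall i, exists x, p x = f i /\ (f i = 0 -> x = 0).
    move=> i; have [->|fi0] := eqVneq (f i) 0.
      by exists 0; rewrite raddf0.
    have E : q (f i) = 0 by have := congr1 (fun h : finsupp W => h i) qf0.
    have [x _ px] : range p (f i) by rewrite -ex.
    by exists x; split=> // /eqP; rewrite (negPf fi0).
  have [r [_ fr]] := finsuppE f.
  have hfs : finsupp_pred h.
    by apply/asboolP; exists r => i /fr; have [_] := hP i.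
  by exists (Finsupp hfs) => //; apply: finsupp_ext => i /=; have [] := hP i.
apply: finsupp_ext => i /=.
suff : range p (p (f i)) by rewrite -ex.
by exists (f i).
Qed.

Section Shift.
Variable M : zmodType.

Lemma shift_subproof (k : int) (f : finsupp M) :
  finsupp_pred (fun i => f (i - k)).
Proof.
have [r [_ fr]] := finsuppE f.
apply/asboolP; exists [seq j + k | j <- r] => i ir; apply: fr.
by apply: contra ir => ir; apply/mapP; exists (i - k); rewrite ?subrK.
Qed.

Definition fs_shift k f : finsupp M := Finsupp (shift_subproof k f).

Lemma fs_shift_is_zmod_morphism k : zmod_morphism (fs_shift k).
Proof. by move=> f g; apply: finsupp_ext. Qed.

HB.instance Definition _ k := GRing.isZmodMorphism.Build (finsupp M) (finsupp M)
  (fs_shift k) (fs_shift_is_zmod_morphism k).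

Lemma fs_shift_monomial k i x :
  fs_shift k (monomial i x) = monomial (i + k) x.
Proof. by apply: finsupp_ext => j /=; rewrite subr_eq. Qed.

Definition fs_diff : {additive finsupp M -> finsupp M} := fs_shift 1 \- idfun.

Lemma fs_diffE f : fs_diff f = fs_shift 1 f - f.
Proof. by []. Qed.

Lemma fs_diff_at f i : fs_diff f i = f (i - 1) - f i.
Proof. by []. Qed.

(** A function invariant under a shift is constant along the integers, which
    forces it to vanish when its support is finite. *)
Lemma fs_diff_inj f : fs_diff f = 0 -> f = 0.
Proof.
move=> f0; have step i : f (i - 1) = f i.
  by apply/eqP; rewrite -subr_eq0 -fs_diff_at f0.
have {}step i (n : nat) : f (i - n%:Z) = f i.
  elim: n => [|n IHn]; first by rewrite subr0.
  by rewrite -[n.+1]addn1 PoszD opprD addrA step.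
have [r [_ fr]] := finsuppE f; apply: finsupp_ext => i.
have bound (s : seq int) : exists n : nat, forall k, k \in s -> i - k < n%:Z.
  elim: s => [|k s [n IHn]]; first by exists 0%N.
  exists (n + `|i - k|.+1)%N => j; rewrite inE => /orP[/eqP -> | /IHn]; lia.
have [n nP] := bound r; rewrite -(step _ n) fr //.
by apply/negP => /nP; lia.
Qed.

(** Modulo differences, a monomial may be moved to any degree; thus the kernel of
    the summation map is the image of [fs_diff]. *)
Lemma fs_diff_range f :
  exists h, f = monomial 0 (finsupp_fold (fun=> idfun) f) + fs_diff h.
Proof.
elim/finsupp_ind: f => [|i x f [h fE]].
  by exists 0; rewrite !raddf0 addr0.
have mon_shift j : monomial (j + 1) x = monomial j x + fs_diff (monomial j x).
  by rewrite fs_diffE fs_shift_monomial addrCA subrr addr0.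
have [h' E] : exists h', monomial i x = monomial 0 x + fs_diff h'.
  elim/int_ind: i => [|n [h' IH]|n [h' IH]].
  - by exists 0; rewrite raddf0 addr0.
  - exists (h' + monomial n x).
    by rewrite -addn1 PoszD mon_shift IH raddfD -addrA.
  - exists (h' - monomial (- n.+1%:Z) x); rewrite raddfB addrA -IH.
    rewrite -[- n%:Z in RHS](_ : - n.+1%:Z + 1 = _); last by lia.
    by rewrite mon_shift addrK.
exists (h' + h).
have -> : finsupp_fold (fun=> idfun) (monomial i x + f)
    = x + finsupp_fold (fun=> idfun) f.
  by rewrite raddfD /= finsupp_fold_monomial.
rewrite (raddfD fs_diff) (raddfD (monomial 0)) {1}fE E.
by rewrite addrACA.
Qed.

End Shift.
End FiniteSupport.

Arguments fs_diff {M}.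

(** * Resolutions over a product with an infinite cyclic group *)

Section ModuleConstructions.
Variable T : groupType.

Definition zero_module : gmodule T.
Proof.
exists 'rV[int]_0 (fun=> (\0 : {additive 'rV[int]_0 -> 'rV[int]_0})%R);
  by move=> *; rewrite [RHS]thinmx0.
Defined.

Lemma zero_module_projective : projective zero_module.
Proof.
move=> M N p f p_eq p_surj f_eq; exists (\0 : {additive _ -> _})%R => [t x|x] /=.
  by rewrite raddf0.
by rewrite [x]thinmx0 !raddf0.
Qed.

Section Product.
Variables M N : gmodule T.

Definition prod_act (t : T) (x : M * N) : M * N :=
  (gm_act M t x.1, gm_act N t x.2).

Lemma prod_act_is_zmod_morphism t : zmod_morphism (prod_act t).
Proof. by move=> [a b] [c d]; rewrite /prod_act /= !raddfB. Qed.

HB.instance Definition _ t := GRing.isZmodMorphism.Build (M * N)%type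
  (M * N)%type (prod_act t) (prod_act_is_zmod_morphism t).

Definition prod_module : gmodule T.
Proof.
exists (M * N)%type (fun t => prod_act t) => [[a b]|s t [a b]].
- by rewrite /= /prod_act /= !gm_act1.
- by rewrite /= /prod_act /= !gm_actM.
Defined.

Lemma prod_module_projective :
  projective M -> projective N -> projective prod_module.
Proof.
move=> M_proj N_proj X Y p f p_eq p_surj f_eq.
pose inM (x : M) : prod_module := (x, 0%R).
pose inN (x : N) : prod_module := (0%R, x).
have inM_add : zmod_morphism inM.
  by move=> x y; rewrite /inM; congr (_, _); rewrite /= subr0.
have inN_add : zmod_morphism inN.
  by move=> x y; rewrite /inN; congr (_, _); rewrite /= subr0.
pose iM : {additive M -> prod_module} := HB.pack inM
  (GRing.isZmodMorphism.Build _ _ inM inM_add).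
pose iN : {additive N -> prod_module} := HB.pack inN
  (GRing.isZmodMorphism.Build _ _ inN inN_add).
have [|g g_eq gP] := M_proj X Y p (f \o iM : {additive _ -> _}) p_eq p_surj.
  by move=> t x /=; rewrite -f_eq /= /prod_act /= raddf0.
have [|h h_eq hP] := N_proj X Y p (f \o iN : {additive _ -> _}) p_eq p_surj.
  by move=> t x /=; rewrite -f_eq /= /prod_act /= raddf0.
pose gh : {additive prod_module -> X} := ((g \o fst) \+ (h \o snd))%R.
exists gh => [t [x y]|[x y]] /=.
  by rewrite raddfD g_eq h_eq.
rewrite raddfD gP hP /= -raddfD; congr (f _).
by rewrite /= /inM /inN /=; congr (_, _); rewrite /= ?addr0 ?add0r.
Qed.

End Product.
End ModuleConstructions.

Section ProductWithZ.
Variable V : zmodType.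
Notation T0 := (Algebra.to_multiplicative V).
Notation T1 := (Algebra.to_multiplicative (V * int)%type).

Definition ground (v : T0) : T1 := (v, 0%R).
Definition stable (k : int) : T1 := (0%R, k).

Lemma ground_is_multiplicative : {morph ground : x y / x * y}.
Proof. by move=> x y; congr (_, _); rewrite /= addr0. Qed.

HB.instance Definition _ :=
  isMultiplicative.Build T0 T1 ground ground_is_multiplicative.

Lemma stable_ground (t : T1) : t = stable t.2 * ground t.1.
Proof. by case: t => v k; congr (_, _); rewrite /= ?add0r ?addr0. Qed.

Lemma ground_stable (v : T0) k : ground v * stable k = stable k * ground v.
Proof. exact: addrC. Qed.

Section Induction.
Variable M : gmodule T0.

(** Induction from [V] to [V * int]: the stable letter shifts, [V] acts on the
    coefficients. *)
Definition ind_act (t : T1) : {additive finsupp M -> finsupp M} :=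
  (fs_shift t.2 \o fs_map (gm_act M t.1))%FUN.

Lemma ind_act_monomial (t : T1) i x :
  ind_act t (monomial i x) = monomial (i + t.2)%R (gm_act M t.1 x).
Proof. by rewrite /= fs_map_monomial fs_shift_monomial. Qed.

Definition ind_module : gmodule T1.
Proof.
exists (finsupp M) (fun t => @ind_act t) => [f|s t f]; apply: finsupp_ext => i /=.
- by rewrite subr0 gm_act1.
- by rewrite opprD addrA gm_actM.
Defined.

(** Induction is left adjoint to restriction: a lift on the coefficients in degree
    [0] extends uniquely to an equivariant lift. *)
Lemma ind_module_projective : projective M -> projective ind_module.
Proof.
move=> M_proj X Y p f p_eq p_surj f_eq.
pose f0 : {additive M -> restrict_scalars ground Y} :=
  (f \o (monomial 0 : {additive M -> ind_module}))%FUN.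
have f0_eq : equivariant f0.
  move=> t x; rewrite /= -f_eq; congr (f _).
  by rewrite [RHS]ind_act_monomial addr0.
have [g g_eq gP] := @M_proj (restrict_scalars ground X) (restrict_scalars ground Y) p f0
  (fun t x => p_eq (ground t) x) p_surj f0_eq.
pose h : {additive ind_module -> X} :=
  finsupp_fold (fun i => (gm_act X (stable i) \o g : {additive M -> X})%FUN).
have h_mon i x : h (monomial i x) = gm_act X (stable i) (g x).
  by rewrite [LHS]finsupp_fold_monomial.
exists h => [t|].
  have : (h \o gm_act ind_module t : {additive _ -> _})%FUN
       =1 (gm_act X t \o h : {additive _ -> _})%FUN; last by [].
  apply: finsupp_morph_eq => i x.
  change (h (ind_act t (monomial i x)) = gm_act X t (h (monomial i x))).
  rewrite ind_act_monomial !h_mon g_eq /= -!gm_actM.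
  congr (gm_act X _ _); rewrite [in RHS](stable_ground t) -mulgA ground_stable.
  by rewrite mulgA; congr (_ * _); congr (_, _); rewrite /= ?addr0 // addrC.
have : (p \o h : {additive _ -> _})%FUN =1 f; last by [].
apply: finsupp_morph_eq => i x.
change (p (h (monomial i x)) = f (monomial i x)).
rewrite h_mon p_eq gP /= -f_eq.
by congr (f _); rewrite [LHS]ind_act_monomial add0r gm_act1.
Qed.

End Induction.

Section Cone.
Variables (P : nat -> gmodule T0) (d : forall k, {additive P k.+1 -> P k}).
Variable e : {additive P 0 -> trivial_int T0}.

(** The mapping cone of [fs_diff], that is, of [t - 1] for the stable letter [t],
    acting on the resolution induced from [P]. *)
Definition cone (k : nat) : gmodule T1 :=
  if k is k'.+1 then prod_module (ind_module (P k'.+1)) (ind_module (P k'))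
  else ind_module (P 0).

Definition cone_top k : {additive finsupp (P k.+1) * finsupp (P k) -> finsupp (P k)} :=
  ((fs_map (d k) \o fst) \+ (@fs_diff (P k) \o snd))%R.

(** The sign on the second component makes the two mixed terms of the square of
    the differential cancel. *)
Definition cone_map k (x : finsupp (P k.+2) * finsupp (P k.+1)) :
    finsupp (P k.+1) * finsupp (P k) :=
  (cone_top k.+1 x, - fs_map (d k) x.2)%R.

Lemma cone_map_is_zmod_morphism k : zmod_morphism (@cone_map k).
Proof.
move=> x y; rewrite /cone_map; congr (_, _); first exact: raddfB.
by rewrite /= raddfB opprB opprK addrC.
Qed.

HB.instance Definition _ k := GRing.isZmodMorphism.Build
  (finsupp (P k.+2) * finsupp (P k.+1))%type
  (finsupp (P k.+1) * finsupp (P k))%type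
  (@cone_map k) (@cone_map_is_zmod_morphism k).

Definition cone_d k : {additive cone k.+1 -> cone k} :=
  if k is k'.+1 return {additive cone k.+1 -> cone k}
  then @cone_map k' else cone_top 0.

Definition cone_aug : {additive cone 0 -> trivial_int T1} := finsupp_fold (fun=> e).

Hypothesis P_proj : forall k, projective (P k).
Hypothesis d_eq : forall k, equivariant (d k).
Hypothesis e_eq : equivariant e.
Hypothesis e_surj : range e = setT.
Hypothesis ex0 : e @^-1` [set 0%R] = range (d 0).
Hypothesis ex : forall k, d k @^-1` [set 0%R] = range (d k.+1).

Lemma cone_projective k : projective (cone k).
Proof.
case: k => [|k]; first exact: ind_module_projective.
by apply: prod_module_projective; apply: ind_module_projective.
Qed.

Lemma fs_map_d_eq k (t : T1) x :
  fs_map (d k) (ind_act (P k.+1) t x) = ind_act (P k) t (fs_map (d k) x).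
Proof. by apply: finsupp_ext => i /=; exact: d_eq. Qed.

Lemma fs_diff_eq (M : gmodule T0) (t : T1) x :
  fs_diff (ind_act M t x) = ind_act M t (fs_diff x).
Proof.
apply: finsupp_ext => i; rewrite fs_diff_at /= -raddfB /=.
by congr (gm_act M _ (x _ - _)%R); rewrite addrAC.
Qed.

Lemma cone_top_eq k (t : T1) x y :
  cone_top k (ind_act (P k.+1) t x, ind_act (P k) t y)
    = ind_act (P k) t (cone_top k (x, y)).
Proof.
have topE u v : cone_top k (u, v) = (fs_map (d k) u + fs_diff v)%R by [].
by rewrite !topE fs_map_d_eq fs_diff_eq [RHS]raddfD.
Qed.

Lemma cone_d_eq k : equivariant (cone_d k).
Proof.
move=> t; case: k => [|k] [x y].
  change (cone_top 0 (ind_act (P 1) t x, ind_act (P 0) t y)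
    = ind_act (P 0) t (cone_top 0 (x, y))).
  exact: cone_top_eq.
change ((cone_top k.+1 (ind_act (P k.+2) t x, ind_act (P k.+1) t y),
         - fs_map (d k) (ind_act (P k.+1) t y))%R
  = (ind_act (P k.+1) t (cone_top k.+1 (x, y)),
     ind_act (P k) t (- fs_map (d k) y))%R).
by rewrite cone_top_eq fs_map_d_eq raddfN.
Qed.

Lemma cone_aug_eq : equivariant cone_aug.
Proof.
move=> t; rewrite /cone_aug /=.
have : (finsupp_fold (fun=> e) \o ind_act (P 0) t : {additive _ -> _})%FUN
       =1 finsupp_fold (fun=> e); last by [].
apply: finsupp_morph_eq => i x.
change (finsupp_fold (fun=> e) (ind_act (P 0) t (monomial i x))
  = finsupp_fold (fun=> e) (monomial i x)).
by rewrite ind_act_monomial !finsupp_fold_monomial e_eq.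
Qed.

Lemma cone_aug_surj : range cone_aug = setT.
Proof.
rewrite -subTset => z _; have [x _ <-] : range e z by rewrite e_surj.
by exists (monomial 0 x) => //; exact: finsupp_fold_monomial.
Qed.

Lemma e_d0 x : e (d 0 x) = 0%R.
Proof. by suff : (e @^-1` [set 0%R]) (d 0 x) by []; rewrite ex0; exists x. Qed.

Lemma d_d k x : d k (d k.+1 x) = 0%R.
Proof. by suff : (d k @^-1` [set 0%R]) (d k.+1 x) by []; rewrite ex; exists x. Qed.

Lemma fs_map_diff (M N : zmodType) (p : {additive M -> N}) f :
  fs_map p (fs_diff f) = fs_diff (fs_map p f).
Proof. by apply: finsupp_ext => i; rewrite fs_diff_at /= -raddfB. Qed.

Lemma fold_aug_diff f : finsupp_fold (fun=> e) (fs_diff f) = 0%R.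
Proof.
have : (finsupp_fold (fun=> e) \o fs_diff : {additive _ -> _})%FUN
       =1 \0%R; last by apply.
apply: finsupp_morph_eq => i x.
change (finsupp_fold (fun=> e) (fs_diff (monomial i x)) = 0%R).
by rewrite fs_diffE fs_shift_monomial raddfB /= !finsupp_fold_monomial subrr.
Qed.

(** The only place where summation over the integers matters: in degree [0] the
    cokernel of [t - 1] on the induced module is the original module. *)
Lemma cone_exact_aug : cone_aug @^-1` [set 0%R] = range (cone_d 0).
Proof.
apply/seteqP; split=> [f /= f0|_ [[x y] _ <-]]; last first.
  change (finsupp_fold (fun=> e) (fs_map (d 0) x + fs_diff y) = 0)%R.
  rewrite raddfD /= fold_aug_diff addr0.
  have : (finsupp_fold (fun=> e) \o fs_map (d 0) : {additive _ -> _})%FUN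
         =1 \0%R; last by apply.
  apply: finsupp_morph_eq => i z.
  change (finsupp_fold (fun=> e) (fs_map (d 0) (monomial i z)) = 0%R).
  by rewrite fs_map_monomial finsupp_fold_monomial e_d0.
have [h fE] := fs_diff_range f; set z := finsupp_fold _ f in fE.
have : e z = 0%R.
  by move: f0; rewrite fE /cone_aug raddfD /= fold_aug_diff addr0 finsupp_fold_monomial.
rewrite -[e z = _]/((e @^-1` [set 0%R]) z) ex0 => -[x _ xz].
exists (monomial 0%R x, h) => //.
change (fs_map (d 0) (monomial 0 x) + fs_diff h = f)%R.
by rewrite fs_map_monomial xz -fE.
Qed.

(** If [(x, y)] is a cycle, then [y] is a boundary: in positive degree by
    exactness of [P], and in degree [0] because [fs_diff] is injective after
    augmentation. Correcting [x] by [fs_diff] of a primitive of [y] gives a cycle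
    of the induced resolution. *)
Lemma cone_exact k : cone_d k @^-1` [set 0%R] = range (cone_d k.+1).
Proof.
have topE j u v : cone_top j (u, v) = (fs_map (d j) u + fs_diff v)%R by [].
have key (x : finsupp (P k.+1)) (y : finsupp (P k)) :
    cone_top k (x, y) = 0%R -> (exists z, fs_map (d k) z = y) ->
  range (@cone_map k) (x, y).
  rewrite topE => xy0 [z zy].
  have : fs_map (d k) (x + fs_diff z)%R = 0%R.
    by rewrite raddfD /= fs_map_diff zy.
  rewrite -[_ = _]/((fs_map (d k) @^-1` [set 0%R]) _) (fs_map_exact (ex k)).
  case=> w _ wE; exists (w, (- z)%R) => //; congr (_, _).
    by rewrite topE wE raddfN addrK.
  by rewrite /= raddfN opprK.
case: k key => [|k] key; apply/seteqP; split=> [[x y] xy0|_ [[x y] _ <-]].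
- have {}xy0 : cone_top 0 (x, y) = 0%R := xy0.
  apply: key => //.
  have : fs_map e y = 0%R.
    apply: fs_diff_inj; rewrite -fs_map_diff.
    have : fs_map e (cone_top 0 (x, y)) = 0%R by rewrite xy0 raddf0.
    rewrite topE raddfD /= => <-; rewrite -[LHS]add0r; congr (_ + _)%R.
    by apply: finsupp_ext => i; rewrite /= e_d0.
  rewrite -[_ = _]/((fs_map e @^-1` [set 0%R]) _) (fs_map_exact ex0).
  by case=> z _ <-; exists z.
- change (cone_top 0 (cone_top 1 (x, y), - fs_map (d 0) y) = 0)%R.
  rewrite !topE raddfD raddfN /= fs_map_diff addrK.
  by apply: finsupp_ext => i; rewrite /= d_d.
- have xy1 : cone_top k.+1 (x, y) = 0%R := congr1 fst xy0.
  have xy2 : (- fs_map (d k) y = 0)%R := congr1 snd xy0.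
  apply: key => //.
  have : fs_map (d k) y = 0%R by apply: oppr_inj; rewrite oppr0.
  rewrite -[_ = _]/((fs_map (d k) @^-1` [set 0%R]) _) (fs_map_exact (ex k)).
  by case=> z _ <-; exists z.
- change ((cone_top k.+1 (cone_top k.+2 (x, y), - fs_map (d k.+1) y),
           - fs_map (d k) (- fs_map (d k.+1) y)) = 0)%R.
  rewrite !topE raddfD !raddfN /= fs_map_diff addrK opprK.
  by congr (_, _); apply: finsupp_ext => i; rewrite /= d_d.
Qed.

End Cone.

Lemma cd_le_prod_int m : cd_le T0 m -> cd_le T1 m.+1.
Proof.
case=> P [d [e [[P_proj d_eq] [e_eq e_surj] ex0 ex P0]]].
exists (cone P), (cone_d d), (cone_aug e); split.
- by split=> k; [exact: cone_projective | exact: cone_d_eq].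
- by split; [exact: cone_aug_eq | exact: cone_aug_surj].
- exact: cone_exact_aug.
- exact: cone_exact ex0 ex.
have fs0 k : (m < k)%N -> forall x : finsupp (P k), x = 0%R.
  by move=> mk x; apply: finsupp_ext => i; rewrite (P0 k mk (x i)).
move=> [|k] //; rewrite ltnS => mk [x y]; congr (_, _); last exact: fs0.
by apply: fs0; exact: leqW.
Qed.

End ProductWithZ.

(** * Virtual cohomological dimension and small subgroups *)

Lemma cd_eq_exists (T : groupType) m :
  cd_le T m -> exists2 k, cd_eq T k & (k <= m)%N.
Proof.
move=> Tm; have ex : exists k, `[< cd_le T k >] by exists m; apply/asboolP.
case: (ex_minnP ex) => k /asboolP Tk k_min; exists k.
  by split=> // l Tl; apply: k_min; apply/asboolP.
by apply: k_min; apply/asboolP.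
Qed.

Lemma cd_le_trivial (T : groupType) : (forall t : T, t = 1) -> cd_le T 0.
Proof.
move=> T1.
pose P k : gmodule T := if k is 0%N then trivial_int T else zero_module T.
have P0 k : forall x : P k.+1, x = 0%R by move=> x; exact: thinmx0.
have act0 (M : gmodule T) t x : gm_act M t x = x by rewrite (T1 t) gm_act1.
exists P, (fun=> \0%R), idfun; split.
- split=> [[|k]|k t x]; [|exact: zero_module_projective|by rewrite /= raddf0].
  move=> M N p f p_eq p_surj f_eq.
  have [x _ px] : range p (f 1%R) by rewrite p_surj.
  pose g (z : int) : M := (x *~ z)%R.
  have g_add : zmod_morphism g by move=> a b; rewrite /g mulrzBr.
  pose gA : {additive trivial_int T -> M} := HB.pack g
    (GRing.isZmodMorphism.Build int M g g_add).
  exists gA => [t z|z]; first by rewrite !act0.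
  by rewrite /= /g raddfMz px -raddfMz /= -mulrzr intz mul1r.
- by split=> //; rewrite -subTset => z _; exists z.
- apply/seteqP; split=> [z /= ->|z [x _ <-]] //.
  by exists 0%R.
- move=> k; apply/seteqP; split=> [x _|x [y _ <-]] //.
  by exists 0%R => //; rewrite [RHS]P0.
- by case.
Qed.

Lemma cd_le_lattice n : cd_le (Algebra.to_multiplicative 'rV[int]_n) n.
Proof.
elim: n => [|n IHn].
  by apply: cd_le_trivial => t; exact: thinmx0.
pose j (u : Algebra.to_multiplicative 'rV[int]_n.+1) :
    Algebra.to_multiplicative ('rV[int]_n * int)%type :=
  ((\row_i u ord0 (lift ord0 i))%R, u ord0 ord0).
have jM : {morph j : x y / x * y}.
  by move=> x y; congr (_, _); [apply/rowP => i|]; rewrite !mxE.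
pose J : {multiplicative _ -> _} := HB.pack j (isMultiplicative.Build _ _ j jM).
apply: (@cd_le_restrict _ _ J _ _ (cd_le_prod_int IHn)) => x y [/rowP xy xy0].
apply/rowP => i; case: (unliftP ord0 i) => [k|] -> //.
by have := xy k; rewrite !mxE.
Qed.

(** Dimension [0] makes the trivial module [Z] projective. Then the extension of
    [Z] by [Z] in which [t] acts by the unipotent matrix with entry [chi t] has
    an equivariant section, and this forces [chi t] to be trivial. *)
Lemma cd_le0_no_hom (T : groupType)
    (chi : {multiplicative T -> Algebra.to_multiplicative int}) :
  cd_le T 0 -> forall t, chi t = 1.
Proof.
case=> P [d [e [[P_proj d_eq] [e_eq e_surj] ex0 ex P0]]] t.
pose act (s : T) (x : int * int) : int * int := (x.1 + chi s * x.2, x.2)%R.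
have act_add s : zmod_morphism (act s).
  move=> [a b] [a' b']; rewrite /act /=; congr (_, _) => /=.
  by rewrite mulrBr opprD addrACA.
pose actA s : {additive (int * int)%type -> (int * int)%type} := HB.pack (act s)
  (GRing.isZmodMorphism.Build _ _ (act s) (act_add s)).
have act1 x : actA 1 x = x.
  by case: x => a b; rewrite /= /act /= hom1 mul0r addr0.
have actM s u x : actA (s * u) x = actA s (actA u x).
  case: x => a b; rewrite /= /act /= gmulfM; congr (_, _).
  by rewrite -addrA; congr (_ + _)%R; rewrite [RHS]addrC -mulrDl.
pose M := GModule act1 actM.
pose p : {additive M -> trivial_int T} := snd.
have [//||g g_eq gP] := P_proj 0%N M (trivial_int T) p e _ _ e_eq.
  by rewrite -subTset => z _; exists (0%R, z).
have e_inj x : e x = 0%R -> x = 0%R.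
  rewrite -[_ = _]/((e @^-1` [set 0%R]) x) ex0 => -[y _ <-].
  by rewrite (P0 1%N isT y) raddf0.
have [x _ ex1] : range e 1%R by rewrite e_surj.
have tx : gm_act (P 0%N) t x = x.
  by apply/eqP; rewrite -subr_eq0; apply/eqP/e_inj; rewrite raddfB e_eq subrr.
have := g_eq t x; rewrite tx => /(congr1 fst) /=.
have -> : ((g x).2 = 1)%R by rewrite -ex1 -gP.
by rewrite mulr1 => E; apply: (@addrI int (g x).1); rewrite -E [RHS]addr0.
Qed.

Section SubgroupType.
Variables (T : groupType) (K : set T).

Definition subgroup_pred : pred T := fun x => `[< K x >].

(** The proof that [K] is a subgroup is an argument so that the group structure
    can be inferred from the type. *)
Definition subgroup_type & subgroup K := {x : T | subgroup_pred x}.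

Variable K_sub : subgroup K.
Notation U := (subgroup_type K_sub).

Lemma subgroup_pred_closed : group_closed subgroup_pred.
Proof.
case: K_sub => K1 KM; split; first exact/asboolP.
by move=> x y /asboolP Kx /asboolP Ky; apply/asboolP/KM.
Qed.

HB.instance Definition _ := SubChoice.on U.
HB.instance Definition _ :=
  SubChoice_isSubGroup.Build T subgroup_pred U subgroup_pred_closed.

Definition subgroup_incl (x : U) : T := val x.

Lemma subgroup_inclM : {morph subgroup_incl : x y / x * y}.
Proof. by []. Qed.

HB.instance Definition _ :=
  isMultiplicative.Build U T subgroup_incl subgroup_inclM.

End SubgroupType.

Section VirtualDimension.
Variable G : groupType.

(** The dimension of a free abelian group of rank [n] is at most [n] by the
    iterated cone, and it is not [0] since the first coordinate is a nontrivial
    homomorphism to [Z]. *)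
Lemma vcd_lattice (A : set G) n :
  free_abelian_of_rank A n -> (0 < n)%N -> finite_index A [set: G] ->
  exists2 m, vcd_eq [set: G] m & (0 < m)%N.
Proof.
case=> phi [phiD phi_inj phi_range] n_gt0 A_fin.
case: n n_gt0 phi phiD phi_inj phi_range => // n _ phi phiD phi_inj phi_range.
pose T := Algebra.to_multiplicative 'rV[int]_n.+1.
pose i : {multiplicative T -> G} :=
  HB.pack (phi : T -> G) (isMultiplicative.Build T G phi phiD).
have [m cd_m _] := cd_eq_exists (cd_le_lattice n.+1).
exists m.
  exists T, i; split=> //; first by rewrite [range i]phi_range.
  move=> u [|k] // _ uk; apply/rowP => l.
  have uE (q : nat) : (u : T) ^+ q = ((u : 'rV[int]_n.+1) *+ q)%R.
    by elim: q => [|q IHq]; rewrite ?expgS ?mulrS ?IHq.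
  have /rowP/(_ l) : ((u : 'rV[int]_n.+1) *+ k.+1 = 0)%R by rewrite -uE uk.
  by rewrite mulmxnE mxE => /eqP; rewrite mulrn_eq0 /= => /eqP.
rewrite lt0n; apply/eqP => m0; rewrite {}m0 in cd_m.
pose chi (u : T) : Algebra.to_multiplicative int := (u : 'rV[int]_n.+1) ord0 ord0.
have chiM : {morph chi : x y / x * y} by move=> x y; rewrite /chi mxE.
pose chiH : {multiplicative T -> Algebra.to_multiplicative int} :=
  HB.pack chi (isMultiplicative.Build _ _ chi chiM).
have := cd_le0_no_hom chiH cd_m.1 (const_mx 1%R : 'rV[int]_n.+1).
by rewrite /= /chi mxE.
Qed.

Lemma vcd_finite (H : set G) : subgroup H -> finite_set H -> vcd_eq H 0.
Proof.
move=> [H1 HM] H_fin; pose T := Algebra.to_multiplicative 'rV[int]_0.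
have T1 (t : T) : t = 1 by exact: thinmx0.
have iM : {morph (fun=> 1 : G) : x y / (x : T) * y >-> x * y}.
  by move=> x y /=; rewrite mulg1.
pose i : {multiplicative T -> G} :=
  HB.pack (fun=> 1 : G) (isMultiplicative.Build T G _ iM).
exists T, i; split=> //.
- by move=> x y _; rewrite [x]T1 [y]T1.
- by move=> _ [t _ <-].
- exists (finmap.enum_fset (fset_set H)) => h Hh; exists h.
    by rewrite in_fset_set // inE.
  by exists 1 => //=; rewrite mulVg.
- by split=> //; exact: cd_le_trivial.
Qed.

(** The preimage of [K] in a torsion-free subgroup of finite index of [H] has
    finite index in [K]: a coset which meets [K] is represented by an element of
    [K]. *)
Lemma vcd_sub (H K : set G) m : vcd_eq H m -> subgroup K -> K `<=` H ->
  exists2 k, vcd_eq K k & (k <= m)%N.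
Proof.
case=> T [i [i_inj iH [s sP] T_tf [cd_m _]]] [K1 KM] KH.
have KV x : K x -> K x^-1 by move=> Kx; rewrite -[_^-1]mul1g; apply: KM.
have KMM x y : K x -> K y -> K (x * y).
  by move=> Kx Ky; rewrite -[y]invgK; apply: KM => //; apply: KV.
have S_sub : subgroup [set t | K (i t)].
  split=> [|x y Kx Ky] /=; first by rewrite hom1.
  by rewrite gmulfM homV; apply: KM.
pose v := @subgroup_incl T _ S_sub.
have v_inj : injective v by move=> x y /val_inj.
have [k cd_k km] := cd_eq_exists (cd_le_restrict v_inj cd_m).
exists k => //.
pose iV : {multiplicative subgroup_type S_sub -> G} := (i \o v)%FUN.
exists (subgroup_type S_sub), iV; split=> //.
- by move=> x y /i_inj/v_inj.
- by move=> _ [u _ <-]; have /asboolP := valP u.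
- pose r x := xget 1 [set y | K y /\ range i (x^-1 * y)].
  exists (map r s) => h Kh; have [x xs [t _ tE]] := sP h (KH _ Kh).
  exists (r x); first exact: map_f.
  have [Kr [t' _ t'E]] : K (r x) /\ range i (x^-1 * r x).
    apply: (@xgetPex _ 1 [set y | K y /\ range i (x^-1 * y)]).
    by exists h; split=> //; exists t.
  have E : (r x)^-1 * h = i (t'^-1 * t).
    by rewrite gmulfM homV t'E tE invgM invgK -mulgA mulVKg.
  have tS : subgroup_pred [set t | K (i t)] (t'^-1 * t).
    by apply/asboolP; rewrite /= -E; exact: KMM (KV _ Kr) Kh.
  by exists (@exist T (subgroup_pred [set t | K (i t)]) _ tS : subgroup_type S_sub).
- move=> x q q0 xq; apply: v_inj; apply: (T_tf _ q q0).
  have vX p : v x ^+ p = v (x ^+ p).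
    by elim: p => [|p IHp]; rewrite ?expgS ?gmulfM ?hom1 ?IHp.
  by rewrite vX xq.
Qed.

Lemma subgroup_conj (H : set G) g : subgroup H -> subgroup [set h ^ g | h in H].
Proof.
case=> H1 HM; split; first by exists 1; rewrite ?conj1g.
by move=> _ _ [x Hx <-] [y Hy <-]; exists (x * y^-1); [exact: HM|rewrite conjMg conjVg].
Qed.

Lemma vcd_conj (H : set G) g m : vcd_eq H m -> vcd_eq [set h ^ g | h in H] m.
Proof.
case=> T [i [i_inj iH [s sP] T_tf cd_m]].
pose c x := i x ^ g.
have cM : {morph c : x y / x * y} by move=> x y; rewrite /c gmulfM conjMg.
pose C : {multiplicative T -> G} := HB.pack c (isMultiplicative.Build _ _ c cM).
exists T, C; split=> //.
- by move=> x y /conjg_inj/i_inj.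
- by move=> _ [t _ <-]; exists (i t) => //; apply: iH; exists t.
- exists (map (fun x => x ^ g) s) => _ [h Hh <-]; have [x xs [t _ tE]] := sP h Hh.
  exists (x ^ g); first by apply/mapP; exists x.
  by exists t => //=; rewrite /c tE conjMg conjVg.
Qed.

Lemma small_subgroups_family (F : finGroupType) (pr : {multiplicative G -> F}) :
  subgroup_family (small_subgroups pr).
Proof.
split=> [H []|H g [Hsub small]|H K [Hsub small] Ksub KH] //.
- split; first exact: subgroup_conj.
  case: small => [[m [k [Hm Gk mk]]]|Hpr]; [left|right].
    by exists m, k; split=> //; exact: vcd_conj.
  move=> E; apply: Hpr; rewrite -subTset => x _.
  have : (pr @` [set h ^ g | h in H]) (x ^ pr g) by rewrite E.
  case=> _ [h Hh <-] hE; exists h => //; apply: (@conjg_inj _ (pr g)).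
  by rewrite -hE /conjg !gmulfM homV.
- split=> //; case: small => [[m [k [Hm Gk mk]]]|Hpr]; [left|right].
    have [l Kl lm] := vcd_sub Hm Ksub KH.
    by exists l, k; split=> //; exact: leq_ltn_trans mk.
  by move=> E; apply: Hpr; rewrite -subTset -E; exact: image_subset.
Qed.

End VirtualDimension.

(** * Points of a complex given by uniform distributions *)

Section Points.
Local Open Scope ring_scope.
Variables (R : realType) (G : groupType) (E : gcomplex G).

Lemma vactVK g : cancel (@vact G E g) (vact g^-1%g).
Proof. by move=> v; rewrite -vactM mulVg vact1. Qed.

Lemma vactKV g : cancel (@vact G E g^-1%g) (vact g).
Proof. by move=> v; rewrite -vactM mulgV vact1. Qed.

Lemma pactM g h (x : E -> R) : pact (g * h)%g x = pact g (pact h x).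
Proof. by apply/funext => v; rewrite /pact invgM vactM. Qed.

Lemma pact1 (x : E -> R) : pact 1%g x = x.
Proof. by apply/funext => v; rewrite /pact invg1 vact1. Qed.

Lemma isotropy_subgroup (x : E -> R) : subgroup (isotropy x).
Proof.
split=> [|g h gx hx]; rewrite /isotropy /=; first exact: pact1.
have hVx : pact h^-1%g x = x by rewrite -{1}hx -pactM mulVg pact1.
by rewrite pactM hVx.
Qed.

Lemma stab_subgroup (v : E) : subgroup [set g | vact g v = v].
Proof.
split=> [|g h gv hv]; first exact: vact1.
by rewrite /= vactM -[in LHS](hv : vact h v = v) vactVK.
Qed.

(** An element that fixes a point preserves its support, which is a simplex, and
    hence fixes every vertex of the support. *)
Lemma isotropy_family (Fam : set (set G)) :
    (forall H K, Fam H -> subgroup K -> K `<=` H -> Fam K) ->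
    (forall v : E, Fam [set g | vact g v = v]) ->
  forall x : E -> R, realisation x -> Fam (isotropy x).
Proof.
move=> FamS FamE x [x_ge0 x_simp x_sum].
have [v xv] := simplex_nonempty x_simp.
apply: (FamS _ _ (FamE v)); first exact: isotropy_subgroup.
move=> g gx; apply: (vact_fix x_simp) => //.
apply/seteqP; split=> [_ [w /= xw <-]|w xw].
  by rewrite -gx /pact vactVK.
exists (vact g^-1%g w); last exact: vactKV.
by move: xw; rewrite /= -{1}gx.
Qed.

Section Uniform.
Variable l : nat.
Hypothesis l_gt0 : (0 < l)%N.

(** The distribution of [r k] for [k] uniform in [0, l); its weights are the
    barycentric coordinates of a point. *)
Definition uniform (r : nat -> E) : E -> R :=
  fun v => (\sum_(k < l) (v == r k)%:R) / l%:R.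

Lemma uniform_ge0 r v : 0 <= uniform r v.
Proof. by rewrite divr_ge0 // sumr_ge0. Qed.

Lemma uniform_support r : [set v | uniform r v != 0] = r @` `I_l.
Proof.
have l0 : l%:R != 0 :> R by rewrite pnatr_eq0 -lt0n.
apply/seteqP; split=> [v /= uv|_ [k /= kl <-]].
  apply: contrapT => rv; move/eqP: uv; apply; rewrite /uniform big1 ?mul0r // => k _.
  case: eqP => // vk; case: rv; exists (k : nat) => //=.
rewrite /= mulf_neq0 ?invr_eq0 // (bigD1 (Ordinal kl)) //= eqxx.
by rewrite lt0r_neq0 // ltr_pwDl // sumr_ge0.
Qed.

Lemma uniform_fsum (s : seq E) (F : E -> R) : uniq s ->
  (forall v, v \notin s -> F v = 0) -> \sum_(v \in [set: E]) F v = \sum_(v <- s) F v.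
Proof.
move=> s_uniq Fs; rewrite (fsbigE s) //; last by move=> v _; apply: Fs.
by apply: eq_bigl => v; rewrite in_setT.
Qed.

Lemma sum_delta (s : seq E) x : uniq s -> x \in s -> \sum_(v <- s) (v == x)%:R = 1 :> R.
Proof.
move=> s_uniq xs; rewrite (bigD1_seq x) //= eqxx big1 ?addr0 // => v /negPf -> //.
Qed.

Lemma uniform_notin r (s : seq E) v :
  (forall k, (k < l)%N -> r k \in s) -> v \notin s -> uniform r v = 0.
Proof.
move=> rs vs; rewrite /uniform big1 ?mul0r // => k _; case: eqP => // vk.
by rewrite vk rs in vs.
Qed.

Lemma uniform_realisation r :
  simplex (r @` `I_l) -> realisation (uniform r).
Proof.
move=> r_simp; split; first exact: uniform_ge0.
  by rewrite uniform_support.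
pose s := undup [seq r k | k <- iota 0 l].
have rs k : (k < l)%N -> r k \in s.
  by move=> kl; rewrite mem_undup map_f // mem_iota.
rewrite (@uniform_fsum s) ?undup_uniq //; last by move=> v; apply: uniform_notin.
rewrite -mulr_suml exchange_big /=.
rewrite (eq_bigr (fun=> 1)) => [|k _]; last by rewrite sum_delta ?undup_uniq ?rs.
by rewrite sumr_const card_ord divff // pnatr_eq0 -lt0n.
Qed.

Lemma uniform_pact g r : pact g (uniform r) = uniform (fun k => vact g (r k)).
Proof.
apply/funext => v; rewrite /pact /uniform; congr (_ / _).
apply: eq_bigr => k _; congr (_%:R); congr nat_of_bool.
by apply/eqP/eqP => [<-|->]; rewrite ?vactKV ?vactVK.
Qed.

(** Each [k] at which [r] and [r'] differ moves a mass [1 / l] from one vertex to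
    another, which costs at most [2 / l]. *)
Lemma uniform_l1dist r r' :
  l1dist (uniform r) (uniform r') <= (2 * \sum_(k < l) (r k != r' k))%:R / l%:R.
Proof.
pose s := undup ([seq r k | k <- iota 0 l] ++ [seq r' k | k <- iota 0 l]).
have rs k : (k < l)%N -> r k \in s.
  by move=> kl; rewrite mem_undup mem_cat map_f ?mem_iota.
have rs' k : (k < l)%N -> r' k \in s.
  by move=> kl; rewrite mem_undup mem_cat orbC map_f ?mem_iota.
rewrite /l1dist (@uniform_fsum s) ?undup_uniq //; last first.
  by move=> v vs; rewrite !(@uniform_notin _ s) // subrr normr0.
rewrite (eq_bigr (fun v => `|\sum_(k < l) ((v == r k)%:R - (v == r' k)%:R)| / l%:R)).
  rewrite -mulr_suml ler_pM2r ?invr_gt0 ?ltr0n //.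
  apply: (@le_trans _ _ (\sum_(v <- s) \sum_(k < l) `|(v == r k)%:R - (v == r' k)%:R|)).
    by apply: ler_sum => v _; exact: ler_norm_sum.
  rewrite exchange_big /= natrM natr_sum mulr_sumr; apply: ler_sum => k _.
  case: eqVneq => [->|_].
    by rewrite big1 ?mulr0 // => v _; rewrite subrr normr0.
  rewrite mulr1 (@le_trans _ _ (\sum_(v <- s) ((v == r k)%:R + (v == r' k)%:R))) //.
    by apply: ler_sum => v _; rewrite (le_trans (ler_normB _ _)) // !normr_nat.
  by rewrite big_split /= !sum_delta ?undup_uniq ?rs ?rs'.
move=> v _; rewrite /uniform -mulrBl normrM [X in _ * X]gtr0_norm ?invr_gt0 ?ltr0n //.
by rewrite sumrB.
Qed.

End Uniform.
End Points.

(** * Subgroups that do not surject onto the finite quotient *)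

Lemma card_le_inj (T : Type) (A : set T) (N : nat) (f : T -> nat) :
  {in A &, injective f} -> (forall x, A x -> (f x <= N)%N) -> (A #<= `I_N.+1)%card.
Proof.
move=> f_inj fN; have /card_eqPle[_ /card_le_trans] := inj_card_eq f_inj; apply.
by apply: subset_card_le => _ [x Ax <-] /=; rewrite ltnS fN.
Qed.

Section ProperSubsets.
Variables (G : groupType) (F : finGroupType) (pr : {multiplicative G -> F}).

(** Left translation of [F] is transitive, so the empty set and [F] are the only
    subsets preserved by all of [F]. *)
Definition nontrivial (X : {set F}) := (X != finset.set0) && (X != [set: F]%SET).

Definition proper_subset := {X : {set F} | nontrivial X}.

Lemma proper_subset_lcoset (g : G) (X : proper_subset) :
  nontrivial (pr g *: val X).
Proof.
case: X => X /= /andP[X0 XT]; rewrite /nontrivial.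
have cX : #|pr g *: X| = #|X| by rewrite card_lcoset.
rewrite -cards_eq0 cX cards_eq0 X0 /=; apply: contra XT => /eqP E.
by rewrite eqEcard finset.subsetT -cX E leqnn.
Qed.

Definition subset_act g X : proper_subset := 
  exist nontrivial _ (proper_subset_lcoset g X).

Definition subset_complex : gcomplex G.
Proof.
exists proper_subset [set s | exists v, s = [set v]]%classic subset_act.
- by move=> _ [v ->]; exact: finite_set1.
- by move=> _ [v ->]; exists v.
- move=> _ t [v ->] tv [w tw]; exists v; apply/seteqP; split=> // _ ->.
  by have /= <- := tv _ tw.
- by move=> v; exists v.
- by move=> v; apply: val_inj; rewrite /= hom1 lcoset1.
- by move=> g h v; apply: val_inj; rewrite /= gmulfM lcosetM.
- by move=> g _ [v ->]; exists (subset_act g v); rewrite image_set1.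
- by move=> g _ [v ->]; rewrite image_set1 => E _ ->;
    have : [set v]%classic (subset_act g v) by rewrite -E.
Defined.

Lemma subset_complex_dim : dim_le subset_complex 0.
Proof.
move=> _ [v ->]; apply: (@card_le_inj _ _ 0 (fun=> 0%N)) => //.
by move=> x y /set_mem -> /set_mem ->.
Qed.

Lemma subset_complex_stab (v : subset_complex) :
  small_subgroups pr [set g | vact g v = v].
Proof.
split; first exact: stab_subgroup.
right=> E; have /andP[/set0Pn[x xv] /eqP vT] := valP (v : proper_subset).
case: vT; apply/setP => y; rewrite inE.
have [g gX gE] : (pr @` [set g | @vact G subset_complex g v = v])
    (y * x^-1)%g by rewrite E.
have <- : val (subset_act g v) = val (v : proper_subset) by congr val.
rewrite /=.
by rewrite mem_lcoset gE invgM invgK mulgKV.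
Qed.

(** The image of [D] in [F] is itself a subset preserved by [D]. *)
Lemma proper_image_complex (R : realType) (D : set G) (S : set G) (eps : R) :
    (0 <= eps)%R -> subgroup D -> pr @` D <> [set: F] ->
  exists (E : gcomplex G) (f : G -> E -> R),
    [/\ dim_le E 0,
        forall x : E -> R, realisation x -> small_subgroups pr (isotropy x),
        forall g, realisation (f g),
        forall d g, D d -> f (d * g) = pact d (f g)
      & forall g g', S (g^-1 * g') -> (l1dist (f g) (f g') <= eps)%R].
Proof.
move=> eps_ge0 [D1 DM] prD.
pose X := [set y | `[< (pr @` D)%classic y >]]%SET.
have XE y : (y \in X) <-> (pr @` D) y by rewrite inE; split=> /asboolP.
have X0 : X != finset.set0.
  by apply/set0Pn; exists 1; apply/XE; exists 1; rewrite ?hom1.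
have XT : X != [set: F]%SET.
  apply/eqP => E; apply: prD; rewrite -subTset => y _.
  by apply/XE; rewrite E inE.
have XP : nontrivial X by rewrite /nontrivial X0.
pose v : subset_complex := exist nontrivial X XP.
exists subset_complex, (fun _ => uniform R 1 (fun=> v)); split=> //.
- exact: subset_complex_dim.
- apply: isotropy_family; first by case: (small_subgroups_family pr).
  exact: subset_complex_stab.
- move=> g; apply: uniform_realisation => //; exists v.
  by apply/seteqP; split=> [_ [k _ <-]|_ ->] //; exists 0%N.
- move=> d g Dd; rewrite uniform_pact; congr (uniform R 1 _); apply/funext => _.
  apply: val_inj; rewrite /=; apply/setP => y; rewrite mem_lcoset.
  have DV x : D x -> D x^-1 by move=> Dx; rewrite -[_^-1]mul1g; apply: DM.
  apply/idP/idP => /XE[x Dx xy]; apply/XE.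
    exists (d^-1 * x); last by rewrite gmulfM homV xy.
    by rewrite -[x]invgK; apply: DM; apply: DV.
  exists (d * x); last by rewrite gmulfM xy mulKVg.
  by rewrite -[x]invgK; apply: DM => //; apply: DV.
- move=> g g' _; apply: le_trans eps_ge0.
  apply: le_trans (uniform_l1dist _ _ _ _) _ => //.
  by rewrite big1 ?muln0 ?mul0r // => k _; rewrite eqxx.
Qed.

End ProperSubsets.

(** * Sums of integer parts *)

Section FloorSums.
Local Open Scope ring_scope.
Variable l : nat.
Hypothesis l_gt0 : (0 < l)%N.

Let l0 : l%:Z != 0. Proof. by rewrite eqz_nat -lt0n. Qed.

(** Raising [y] by [1] shifts the window of [l] consecutive integers, which
    replaces [y %/ l] by [(y + l) %/ l]. *)
Lemma hermite_identity (y : int) :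
  \sum_(0 <= k < l) ((y + k%:Z) %/ l%:Z)%Z = y.
Proof.
pose H (y : int) : int := \sum_(0 <= k < l) ((y + k%:Z) %/ l%:Z)%Z.
have HS z : H (z + 1) = H z + 1.
  have E : H (z + 1) = \sum_(1 <= k < l.+1) ((z + k%:Z) %/ l%:Z)%Z.
    by rewrite big_add1; apply: eq_bigr => k _; rewrite -addn1 PoszD addrAC addrA.
  have : \sum_(0 <= k < l.+1) ((z + k%:Z) %/ l%:Z)%Z = (z %/ l%:Z)%Z + H (z + 1).
    by rewrite big_ltn // addr0 E.
  rewrite big_nat_recr //= -/(H z) divzDr ?dvdzz // divzz l0 /=.
  by move: (z %/ l%:Z)%Z (H z) (H (z + 1)) => q a b; lia.
have H0 : H 0 = 0.
  rewrite /H big_nat big1 // => k /andP[_ kl].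
  by rewrite add0r divz_small // kl ltz_nat.
rewrite -/(H y); elim/int_ind: y => [//|n IHn|n IHn].
  by rewrite -addn1 PoszD HS IHn.
by apply: (addIr 1); rewrite -HS (_ : - n.+1%:Z + 1 = - n%:Z) ?IHn //; lia.
Qed.

(** For [y <= z] the differences of the integer parts are nonnegative integers,
    with sum [z - y] by Hermite's identity. *)
Lemma floor_change_count (y z : int) :
  ((\sum_(k < l) (((y + k%:Z) %/ l%:Z)%Z != ((z + k%:Z) %/ l%:Z)%Z))%N <= `|y - z|)%N.
Proof.
wlog yz : y z / y <= z => [H|].
  case: (lerP y z) => [|/ltW zy]; first exact: H.
  by rewrite -abszN opprB; apply: leq_trans (H _ _ zy); apply: leq_sum => k _;
    rewrite eq_sym.
rewrite -lez_nat -abszN opprB gez0_abs ?subr_ge0 //.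
rewrite -[z in leRHS]hermite_identity -[y in leRHS]hermite_identity -sumrB.
rewrite big_mkord (big_morph Posz PoszD (erefl _)); apply: ler_sum => k _.
have : ((y + k%:Z) %/ l%:Z)%Z <= ((z + k%:Z) %/ l%:Z)%Z.
  by apply: lez_pdiv2r => //; rewrite lerD2r.
by case: eqP => [->|]; rewrite ?subrr //= => ne le; lia.
Qed.

Lemma floor_step (y : int) (j k : nat) : (j <= k)%N -> (k < j + l)%N ->
  exists b : bool, ((y + k%:Z) %/ l%:Z)%Z = ((y + j%:Z) %/ l%:Z)%Z + b%:Z.
Proof.
move=> jk kj; set a := (_ %/ _)%Z; set c := (_ %/ _)%Z.
have ca : c <= a by apply: lez_pdiv2r => //; rewrite lerD2l lez_nat.
have : a <= c + 1.
  rewrite /c -[1](_ : (l%:Z %/ l%:Z)%Z = _); last by rewrite divzz l0.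
  rewrite -divzDr ?dvdzz //; apply: lez_pdiv2r => //; lia.
by exists (a != c); case: eqP => [->|] /=; lia.
Qed.

End FloorSums.

(** * A triangulation at scale [l] *)

Section LatticeExtension.
Variables (G : groupType) (F : finGroupType) (pr : {multiplicative G -> F}).
Variables (n : nat) (phi : 'rV[int]_n -> G).
Hypothesis phiD : forall u v, phi (u + v)%R = phi u * phi v.
Hypothesis phi_inj : injective phi.
Hypothesis pr_ker : forall g, pr g = 1 <-> exists u, phi u = g.

Lemma phi0 : phi 0%R = 1.
Proof. by apply: (mulgI (phi 0%R)); rewrite -phiD addr0 mulg1. Qed.

Lemma phiN u : phi (- u)%R = (phi u)^-1.
Proof. by apply: (mulgI (phi u)); rewrite -phiD subrr phi0 mulgV. Qed.

Lemma pr_phi u : pr (phi u) = 1.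
Proof. by apply/pr_ker; exists u. Qed.

Lemma same_coset x y : pr x = pr y -> exists u, y = x * phi u.
Proof.
move=> xy; have /pr_ker[u uE] : pr (x^-1 * y) = 1 by rewrite gmulfM homV xy mulVg.
by exists u; rewrite uE mulVKg.
Qed.

Variable sec : F -> G.
Hypothesis secK : forall f, pr (sec f) = f.

Variable tau : G -> 'rV[int]_n.
Hypothesis tauE : forall g, g = phi (tau g) * sec (pr g).

Lemma tau_phi u g : tau (phi u * g) = (u + tau g)%R.
Proof.
apply: phi_inj; apply: (@mulIg _ (sec (pr g))).
have E : pr (phi u * g) = pr g by rewrite gmulfM pr_phi mul1g.
by rewrite phiD -mulgA -tauE -E -tauE.
Qed.

(** The difference is unchanged when [y] is multiplied by an element of [A] on the
    left, so only finitely many values of [y] matter. *)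
Lemma tau_bounded (S : set G) : finite_set S ->
  exists C : nat, forall y s i, S s ->
    (`|tau (y * s) ord0 i - tau y ord0 i| <= C)%N.
Proof.
move=> S_fin.
exists (\sum_(s <- finmap.enum_fset (fset_set S)) \sum_(f : F) \sum_(i < n)
  `|(tau (sec f * s) ord0 i - tau (sec f) ord0 i)%R|)%N => y s i Ss.
have -> : (tau (y * s) ord0 i - tau y ord0 i
    = tau (sec (pr y) * s) ord0 i - tau (sec (pr y)) ord0 i)%R.
  have E t : tau (y * t) = (tau y + tau (sec (pr y) * t))%R.
    by rewrite -tau_phi mulgA -tauE.
  have := congr1 (fun u : 'rV_n => u ord0 i) (E 1); rewrite !mulg1 (E s) !mxE.
  move: (tau y ord0 i) (tau (sec _) ord0 i) (tau (sec _ * s) ord0 i) => a b c.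
  by lia.
have sS : s \in finmap.enum_fset (fset_set S).
  by rewrite in_fset_set // inE.
rewrite (big_rem s) //= (bigD1 (pr y)) //= (bigD1 i) //= -!addnA.
exact: leq_addr.
Qed.

Section Kuhn.
Local Open Scope ring_scope.
Variable l : nat.
Hypothesis l_gt0 : (0 < l)%N.

(** The values on the cosets of [A] are independent, and one value per coset
    determines the function: this encodes an affine copy of the lattice induced
    from [A], with the action of [G] by translation of the argument. *)
Definition affine : pred (G -> 'rV[int]_n) :=
  fun W => `[< forall x u, W (x * phi u)%g = W x - u >].

Definition kvertex := {W : G -> 'rV[int]_n | affine W}.

Definition kfun (W : kvertex) : G -> 'rV[int]_n := val W.

Lemma kfun_phi W x u : kfun W (x * phi u)%g = kfun W x - u.
Proof. by have /asboolP := valP W; apply. Qed.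

Lemma kvertex_eq (V W : kvertex) :
  (forall f i, kfun V (sec f) ord0 i = kfun W (sec f) ord0 i) -> V = W.
Proof.
move=> VW; apply/val_inj/funext => x.
have [u ->] : exists u, x = (sec (pr x) * phi u)%g by apply: same_coset; rewrite secK.
rewrite -!/(kfun _ _) !kfun_phi; congr (_ - _).
by apply/rowP => i; exact: VW.
Qed.

Lemma kact_subproof (g : G) (W : kvertex) :
  affine (fun x => kfun W (g^-1 * x)%g).
Proof. by apply/asboolP => x u; rewrite mulgA kfun_phi. Qed.

Definition kact g W : kvertex := exist affine _ (kact_subproof g W).

Lemma kact1 W : kact 1 W = W.
Proof. by apply/val_inj/funext => x; rewrite /= invg1 mul1g. Qed.

Lemma kactM g h W : kact (g * h)%g W = kact g (kact h W).
Proof. by apply/val_inj/funext => x; rewrite /= /kfun /= invgM mulgA. Qed.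

Definition kstep (V W : kvertex) : Prop :=
  forall x i, exists b : bool, kfun W x ord0 i = kfun V x ord0 i + (l * b)%:Z.

Lemma kstep_refl V : kstep V V.
Proof. by move=> x i; exists false; rewrite muln0 addr0. Qed.

Lemma kstep_act g V W : kstep V W -> kstep (kact g V) (kact g W).
Proof. by move=> VW x i; have [b bE] := VW (g^-1 * x)%g i; exists b. Qed.

(** A strictly increasing function on chains, used to bound their length and to
    show that an increasing orbit in a finite chain is constant. *)
Definition height (V0 V : kvertex) : int :=
  \sum_(f : F) \sum_(i < n) (kfun V (sec f) ord0 i - kfun V0 (sec f) ord0 i).

Lemma height_refl V : height V V = 0.
Proof. by rewrite /height big1 // => f _; rewrite big1 // => i _; rewrite subrr. Qed.

Lemma height_step V0 V W : kstep V W -> V <> W ->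
  height V0 V + l%:Z <= height V0 W.
Proof.
move=> VW neq.
have mono f i : kfun V (sec f) ord0 i - kfun V0 (sec f) ord0 i
              <= kfun W (sec f) ord0 i - kfun V0 (sec f) ord0 i.
  by rewrite lerD2r; have [b ->] := VW (sec f) i; rewrite lerDl.
have [[f i] fi] : exists p : F * 'I_n,
    kfun V (sec p.1) ord0 p.2 != kfun W (sec p.1) ord0 p.2.
  apply: contrapT => no; apply: neq; apply: kvertex_eq => f i.
  by apply/eqP/negPn/negP => ne; apply: no; exists (f, i).
rewrite /height (bigD1 f) //= [leRHS](bigD1 f) //= addrAC lerD //; last first.
  by apply: ler_sum => f' _; apply: ler_sum => i' _; exact: mono.
rewrite (bigD1 i) //= [leRHS](bigD1 i) //= addrAC lerD //; last first.
  by apply: ler_sum => i' _; exact: mono.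
have [b /= bE] := VW (sec f) i; move: fi; rewrite /= bE.
by case: b {bE} => /=; rewrite ?muln0 ?muln1 ?addr0 ?eqxx // => _; lia.
Qed.

Lemma height_mono V0 V W : kstep V W -> height V0 V <= height V0 W.
Proof.
move=> VW; have [->//|ne] := pselect (V = W).
by apply: le_trans (height_step V0 VW ne); rewrite lerDl.
Qed.

Lemma height_le V W : kstep V W -> height V W <= (#|F| * n * l)%:Z.
Proof.
move=> VW; rewrite /height.
rewrite (@le_trans _ _ (\sum_(f : F) \sum_(i < n) l%:Z)) //.
  apply: ler_sum => f _; apply: ler_sum => i _.
  by have [b ->] := VW (sec f) i; rewrite addrAC subrr add0r; case: b; lia.
rewrite !sumr_const card_ord -mulrnA -mulr_natr natz -PoszM lez_nat.
by rewrite mulnC [(n * _)%N]mulnC.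
Qed.

Lemma height_ge V W : kstep W V -> - (#|F| * n * l)%:Z <= height V W.
Proof.
move=> VW; rewrite lerNl (le_trans _ (height_le VW)) //.
rewrite /height -sumrN; apply: ler_sum => f _; rewrite -sumrN.
by apply: ler_sum => i _; rewrite opprB.
Qed.

Definition ksimplex : set (set kvertex) :=
  [set s | [/\ finite_set s, s !=set0
    & forall V W, s V -> s W -> kstep V W \/ kstep W V]].

(** Otherwise the orbit of [V] would be strictly increasing, and so would its
    heights, which are bounded by [height_le]. *)
Lemma kact_increasing_fix g V : kstep V (kact g V) ->
  (forall k, kstep V (kact (g ^+ k)%g V)) -> kact g V = V.
Proof.
move=> Vg Vgk; apply: contrapT => neq.
have grow k : (k * l)%:Z <= height V (kact (g ^+ k)%g V).
  elim: k => [|k IHk]; first by rewrite mul0n expg0 kact1 height_refl.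
  apply: (@le_trans _ _ (height V (kact (g ^+ k)%g V) + l%:Z)).
    by rewrite mulSn addnC PoszD lerD2r.
  rewrite expgSr kactM; apply: height_step; first exact: kstep_act.
  move=> /(congr1 (kact (g ^- k)%g)); rewrite -!kactM mulVg mul1g kact1 => E.
  by apply: neq; rewrite -E.
have := le_trans (grow (#|F| * n).+1) (height_le (Vgk _)).
by rewrite lez_nat leq_pmul2r // ltnn.
Qed.

(** The triangulation of Kuhn and Freudenthal, scaled by [l], of every residue
    class modulo [l]. *)
Definition kuhn : gcomplex G.
Proof.
exists kvertex ksimplex kact.
- by move=> s [].
- by move=> s [].
- move=> s t [s_fin _ s_chain] ts t0; split=> //.
    exact: sub_finite_set s_fin.
  by move=> V W /ts sV /ts sW; exact: s_chain.
- move=> V; split; [exact: finite_set1|by exists V|].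
  by move=> _ _ -> ->; left; exact: kstep_refl.
- exact: kact1.
- exact: kactM.
- move=> g s [s_fin [V sV] s_chain]; split; first exact: finite_image.
    by exists (kact g V); exists V.
  move=> _ _ [W sW <-] [W' sW' <-].
  by case: (s_chain _ _ sW sW') => /(kstep_act g); [left|right].
- move=> g s [s_fin _ s_chain] gs V sV.
  have stab (h : G) : kact h @` s = s -> forall W, s W -> s (kact h W).
    by move=> hs W sW; rewrite -hs; exists W.
  have powers (h : G) : kact h @` s = s -> forall k, s (kact (h ^+ k)%g V).
    move=> hs; elim=> [|k IHk]; first by rewrite expg0 kact1.
    by rewrite expgS kactM; exact: stab.
  (* If [h] raises [V], heights do not decrease along the orbit of [V], so every
     member of the orbit is above [V]. *)
  have fwd (h : G) : kact h @` s = s -> kstep V (kact h V) -> kact h V = V.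
    move=> hs Vh; apply: kact_increasing_fix => // k.
    case: (s_chain _ _ sV (powers h hs k)) => // back.
    have ge0 j : 0 <= height V (kact (h ^+ j)%g V).
      elim: j => [|j IHj]; first by rewrite expg0 kact1 height_refl.
      apply: le_trans IHj _; rewrite expgSr kactM.
      by apply: height_mono; exact: kstep_act.
    have [E|ne] := pselect (kact (h ^+ k)%g V = V).
      by rewrite E; exact: kstep_refl.
    have := height_step V back ne; rewrite height_refl.
    by have := ge0 k; lia.
  case: (s_chain _ _ sV (stab g gs V sV)) => [/(fwd g gs)//|gV].
  (* If [g] lowers [V], its inverse raises [V]. *)
  have gVs : kact g^-1%g @` s = s.
    rewrite -{1}gs image_comp -[RHS]image_id; apply: eq_imagel => W _ /=.
    by rewrite -kactM mulVg kact1.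
  have VgV : kstep V (kact g^-1%g V).
    by have := kstep_act g^-1%g gV; rewrite -kactM mulVg kact1.
  by rewrite -{1}(fwd _ gVs VgV) -kactM mulgV kact1.
Defined.

(** Heights relative to a fixed vertex [V0] of the simplex lie between
    [- #|F| n l] and [#|F| n l], and those of distinct vertices differ by at
    least [l]. *)
Lemma kuhn_dim : dim_le kuhn (2 * (#|F| * n)).
Proof.
move=> s [_ [V0 sV0] s_chain]; set M := (#|F| * n)%N.
have bound V : s V -> - (M * l)%:Z <= height V0 V <= (M * l)%:Z.
  move=> sV; case: (s_chain _ _ sV0 sV) => [up|down].
    rewrite height_le // andbT (@le_trans _ _ 0) //; first by rewrite oppr_le0.
    by rewrite -(height_refl V0); exact: height_mono.
  rewrite height_ge // (@le_trans _ _ 0) //.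
  by rewrite -[leRHS](height_refl V0); exact: height_mono.
pose rk (V : kvertex) := (`|(height V0 V + (M * l)%:Z)%R| %/ l)%N.
have rk_step V W : s V -> s W -> kstep V W -> V <> W -> (rk V < rk W)%N.
  move=> sV sW VW ne; have hVW := height_step V0 VW ne.
  have /andP[lowV _] := bound _ sV; have /andP[lowW _] := bound _ sW.
  have divS a : ((a %/ l).+1 = (a + l) %/ l)%N.
    by rewrite divnDr ?dvdnn // divnn l_gt0 addn1.
  by rewrite /rk divS; apply: leq_div2r; lia.
apply: (@card_le_inj _ _ _ rk) => [V W /set_mem sV /set_mem sW VW|V sV].
  apply: contrapT => ne; have neq : W <> V by move=> E; apply: ne.
  case: (s_chain _ _ sV sW) => [/rk_step|/rk_step].
    by move=> /(_ sV sW ne); rewrite VW ltnn.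
  by move=> /(_ sW sV neq); rewrite VW ltnn.
have /andP[low high] := bound _ sV.
rewrite -(mulnK (2 * M) l_gt0); apply: leq_div2r; rewrite -mulnA; lia.
Qed.

(** Translation by [phi u] adds [u] to the value at [1], so only [u = 0]
    fixes a vertex: the stabiliser injects into [F]. *)
Lemma kuhn_stab_finite (V : kuhn) : finite_set [set g | vact g V = V].
Proof.
pose H := [set g | @vact G kuhn g V = V].
have [H1 HM] : subgroup H := stab_subgroup V.
have HV g : H g -> H g^-1%g by move=> Hg; rewrite -[(g^-1)%g]mul1g; exact: HM.
have H_inj g h : H g -> H h -> pr g = pr h -> g = h.
  move=> Hg Hh gh; have [u hu] := same_coset gh.
  have Hu : H (phi u).
    have -> : phi u = (g^-1 * h)%g by rewrite hu mulKg.
    by rewrite -[h]invgK; exact: HM (HV _ Hg) (HV _ Hh).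
  have : kfun V ((phi u)^-1 * 1)%g = kfun V 1%g.
    exact: (congr1 (fun W : kvertex => kfun W 1%g) Hu).
  rewrite mulg1 -phiN -[phi _]mul1g kfun_phi opprK -[RHS]addr0 => /addrI u0.
  by rewrite hu u0 phi0 mulg1.
pose r f := xget 1%g [set g | H g /\ pr g = f].
apply: (@sub_finite_set _ _ (r @` [set: F])); last exact/finite_image/finite_finset.
move=> g Hg; exists (pr g) => //.
have [Hr rg] : H (r (pr g)) /\ pr (r (pr g)) = pr g.
  by apply: (@xgetPex _ 1%g [set h | H h /\ pr h = pr g]); exists g.
exact: H_inj.
Qed.

Section Contraction.
Variable D : set G.
Hypothesis D_sub : subgroup D.
Hypothesis prD : pr @` D = [set: F].
Hypothesis D_div : forall u, D (phi u) -> exists w, u = w *+ l.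

Lemma D_decomposition x : exists u d, D d /\ x = (d * phi u)%g.
Proof.
have [d Dd dx] : (pr @` D) (pr x) by rewrite prD.
by have [u ->] := same_coset dx; exists u, d.
Qed.

(** Writing [x = d * phi u] with [d] in [D], put [beta x := - u]. The vector [u]
    is unique modulo [l] because [D] meets [A] within [l A]. *)
Lemma residue_exists : exists beta : G -> 'rV[int]_n,
  forall d x u, D d -> exists w, beta (d * x * phi u)%g = beta x - u + w *+ l.
Proof.
have /choice[a aP] := D_decomposition; exists (fun x => - a x) => d x u Dd.
have [d1 [Dd1 x1]] := aP x; have [d2 [Dd2 x2]] := aP (d * x * phi u)%g.
set a2 := a (d * x * phi u)%g in x2 *.
have [D1 DM] := D_sub.
have DV g : D g -> D g^-1%g by move=> Dg; rewrite -[(g^-1)%g]mul1g; exact: DM.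
have DMM g h : D g -> D h -> D (g * h)%g.
  by move=> Dg Dh; rewrite -[h]invgK; apply: DM => //; exact: DV.
have E : (d2^-1 * (d * d1))%g = phi (a2 - a x - u).
  have d1E : d1 = (x * phi (- a x))%g.
    by apply: (@mulIg _ (phi (a x))); rewrite -mulgA -phiD addNr phi0 mulg1 -x1.
  have E2 : (d * x)%g = (d2 * phi (a2 - u)%R)%g.
    by apply: (@mulIg _ (phi u)); rewrite x2 -mulgA -phiD subrK.
  by rewrite d1E (mulgA d) E2 -mulgA -phiD mulKg addrAC.
have [w wE] : exists w, a2 - a x - u = w *+ l.
  by apply: D_div; rewrite -E; exact: DMM (DV _ Dd2) (DMM _ _ Dd Dd1).
exists (- w); rewrite mulNrn -wE; apply: (@addIr _ (a2 - a x - u)).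
by rewrite subrK !addrA addNr add0r.
Qed.

Variable beta : G -> 'rV[int]_n.
Hypothesis betaP : forall d x u, D d ->
  exists w, beta (d * x * phi u)%g = beta x - u + w *+ l.

(** The integer [m] such that [beta + l m] is the largest member of its residue
    class below the coordinate [tau (x^-1 * g) + k] of the translated point. *)
Definition level (k : nat) (g x : G) (i : 'I_n) : int :=
  ((tau (x^-1 * g)%g ord0 i - beta x ord0 i + k%:Z) %/ l%:Z)%Z.

Definition round_fun (k : nat) (g x : G) : 'rV[int]_n :=
  \row_i (beta x ord0 i + l%:Z * level k g x i).

Lemma round_fun_eq k g d x u : D d ->
  round_fun k (d * g)%g (d * x * phi u)%g = round_fun k g x - u.
Proof.
move=> Dd; apply/rowP => i; rewrite !mxE /level.
have -> : ((d * x * phi u)^-1 * (d * g) = phi (- u) * (x^-1 * g))%g.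
  by rewrite phiN !invgM -!mulgA mulKg.
have [w ->] := betaP x u Dd; rewrite tau_phi !mxE mulmxnE.
set X := tau _ _ _; set b := beta _ _ _; set c := w _ _; set v := u _ _.
have -> : - v + X - (b - v + c *+ l) + k%:Z = (- c) * l%:Z + (X - b + k%:Z).
  by rewrite -mulr_natr natz; ring.
rewrite divzMDl ?eqz_nat -?lt0n // -mulr_natr natz; ring.
Qed.

Lemma round_subproof k g : affine (round_fun k g).
Proof.
have [D1 _] := D_sub.
by apply/asboolP => x u; have := round_fun_eq k g x u D1; rewrite !mul1g.
Qed.

Definition round k g : kuhn := exist affine _ (round_subproof k g).

(** The coordinate of the point [g] at [x] depends on [x^-1 * g] only, and [beta]
    is invariant under [D] modulo [l]. *)
Lemma round_act k d g : D d -> round k (d * g)%g = vact d (round k g).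
Proof.
move=> Dd; apply/val_inj/funext => x.
have := round_fun_eq k g (d^-1 * x)%g 0 Dd.
by rewrite phi0 mulg1 mulKVg subr0.
Qed.

(** As [k] grows from [0] to [l - 1], each coordinate is rounded up at most
    once. *)
Lemma round_simplex g : ksimplex [set round k g | k in `I_l].
Proof.
split; first exact/finite_image/finite_II.
  by exists (round 0 g); exists 0%N.
have mono j k : (j <= k)%N -> (k < l)%N -> kstep (round j g) (round k g).
  move=> jk kl x i; rewrite /kfun /= !mxE /level.
  have kjl : (k < j + l)%N by exact: leq_trans (leq_addl _ _).
  have [b ->] := @floor_step l l_gt0
    (tau (x^-1 * g)%g ord0 i - beta x ord0 i) j k jk kjl.
  by exists b; rewrite mulrDr addrA PoszM.
move=> _ _ [j /= jl <-] [k /= kl <-].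
by case: (leqP j k) => [jk|/ltnW kj]; [left|right]; exact: mono.
Qed.

(** A rounded point changes only if one of its [n #|F|] coordinates does. *)
Lemma round_changes (C : nat) g g' :
    (forall x i, (`|tau (x^-1 * g)%g ord0 i - tau (x^-1 * g')%g ord0 i| <= C)%N) ->
  (\sum_(k < l) (round k g != round k g') <= #|F| * n * C)%N.
Proof.
move=> close.
apply: (@leq_trans (\sum_(k < l) \sum_(f : F) \sum_(i < n)
    (level k g (sec f) i != level k g' (sec f) i))).
  apply: leq_sum => k _; case: eqVneq => //= ne.
  have [[f i] fi] : exists p : F * 'I_n,
      level k g (sec p.1) p.2 != level k g' (sec p.1) p.2.
    apply: contrapT => no; case/eqP: ne; apply: kvertex_eq => f i.
    rewrite /kfun /= !mxE; congr (_ + _ * _).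
    by apply/eqP/negPn/negP => ne; apply: no; exists (f, i).
  by rewrite (bigD1 f) //= (bigD1 i) //= fi.
rewrite exchange_big /=.
have -> : (#|F| * n * C = \sum_(f : F) \sum_(i < n) C)%N.
  by rewrite !sum_nat_const card_ord -mulnA.
apply: leq_sum => f _; rewrite exchange_big /=; apply: leq_sum => i _.
apply: leq_trans (floor_change_count l_gt0 _ _) _.
by have := close (sec f) i; lia.
Qed.

End Contraction.

Lemma contracting_complex (R : realType) (D S : set G) (C : nat) (eps : R) :
    subgroup D -> pr @` D = [set: F] ->
    (forall u, D (phi u) -> exists w, u = w *+ l) ->
    (forall y s i, S s -> (`|(tau (y * s)%g ord0 i - tau y ord0 i)%R| <= C)%N) ->
    (forall H, subgroup H -> finite_set H -> small_subgroups pr H) ->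
    (2 * (#|F| * n * C))%:R / l%:R <= eps ->
  exists (E : gcomplex G) (f : G -> E -> R),
    [/\ dim_le E (2 * (#|F| * n)),
        forall x : E -> R, realisation x -> small_subgroups pr (isotropy x),
        forall g, realisation (f g),
        forall d g, D d -> f (d * g)%g = pact d (f g)
      & forall g g', S (g^-1 * g')%g -> l1dist (f g) (f g') <= eps].
Proof.
move=> D_sub prD D_div tau_close small C_eps.
have [beta betaP] := residue_exists D_sub prD D_div.
exists kuhn, (fun g => uniform R l (fun k => round D_sub betaP k g)); split.
- exact: kuhn_dim.
- apply: isotropy_family; first by case: (small_subgroups_family pr).
  by move=> V; apply: small; [exact: stab_subgroup|exact: kuhn_stab_finite].
- by move=> g; apply: uniform_realisation => //; exact: round_simplex.
- move=> d g Dd; rewrite uniform_pact; congr (uniform R l _).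
  by apply/funext => k; exact: round_act.
move=> g g' Sgg'; apply: le_trans C_eps.
apply: le_trans (uniform_l1dist _ _ _ _) _ => //.
rewrite ler_pM2r ?invr_gt0 ?ltr0n // ler_nat leq_pmul2l //.
apply: round_changes => x i; rewrite -abszN opprB.
by have := tau_close (x^-1 * g)%g _ i Sgg'; rewrite -mulgA mulKVg.
Qed.

End Kuhn.
End LatticeExtension.

(** * Finite quotients and their depth *)

Section TransportedGroup.
Variables (T : finType) (mul : T -> T -> T) (one : T) (inv : T -> T).

(** The group axioms are arguments of this copy of [T], so that the group
    structure can be inferred from the type. *)
Definition group_on & associative mul & left_id one mul & left_inverse one inv mul :=
  Finite.sort T.

Variables (mulA : associative mul) (mul1 : left_id one mul)
  (mulV : left_inverse one inv mul).

HB.instance Definition _ := Finite.on (group_on mulA mul1 mulV).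
HB.instance Definition _ :=
  Finite_isGroup.Build (group_on mulA mul1 mulV) mulA mul1 mulV.

End TransportedGroup.

(** The carrier is [T] itself, so that the order of the quotient is known. *)
Lemma finite_quotient (G : groupType) (T : finType) (c : G -> T) :
    (forall t, exists g, c g = t) ->
    (forall x x' y y', c x = c x' -> c y = c y' -> c (x * y) = c (x' * y')) ->
  exists (Q : finGroupType) (p : {multiplicative G -> Q}),
    [/\ #|Q| = #|T|, range p = [set: Q] & forall x y, p x = p y <-> c x = c y].
Proof.
move=> c_surj cM; have /choice[r rK] := c_surj.
pose mul s t := c (r s * r t).
pose inv t := c (r t)^-1.
have mulA : associative mul.
  move=> s t u; rewrite /mul.
  have -> : c (r s * r (c (r t * r u))) = c (r s * (r t * r u)) by exact: cM.
  by rewrite mulgA; exact: cM.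
have mul1 : left_id (c 1) mul.
  by move=> t; rewrite /mul (cM _ 1 _ (r t)) ?rK // mul1g rK.
have mulV : left_inverse (c 1) inv mul.
  by move=> t; rewrite /mul (cM _ (r t)^-1 _ (r t)) ?rK // mulVg.
pose Q : finGroupType := group_on mulA mul1 mulV.
have pM : {morph (c : G -> Q) : x y / x * y}.
  by move=> x y; apply: cM; rewrite rK.
pose p : {multiplicative G -> Q} :=
  HB.pack (c : G -> Q) (isMultiplicative.Build G Q (c : G -> Q) pM).
exists Q, p; split=> //.
  by apply: (@bij_eq_card Q T id); exists id.
apply/seteqP; split=> // t _; have [g <-] := c_surj t.
by exists g.
Qed.

Section Depth.

(** The number of prime factors, counted with multiplicity. *)
Definition Omega (m : nat) : nat := \sum_(p < m.+1) logn p m.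

Lemma Omega_widen m N : (m < N)%N -> Omega m = \sum_(p < N) logn p m.
Proof.
case: m => [|m] mN.
  by rewrite /Omega !big1 // => p _; rewrite logn0.
rewrite /Omega -!(big_mkord xpredT (fun p => logn p m.+1)).
rewrite [RHS](big_cat_nat _ (n := m.+2)) //= [X in (_ + X)%N]big_nat.
rewrite [X in (_ + X)%N]big1 ?addn0 //.
by move=> p /andP[mp _]; exact: ltn_log0.
Qed.

Lemma OmegaM a b : (0 < a)%N -> (0 < b)%N -> Omega (a * b) = (Omega a + Omega b)%N.
Proof.
move=> a0 b0; rewrite (@Omega_widen a (a * b).+1) ?ltnS ?leq_pmulr //.
rewrite (@Omega_widen b (a * b).+1) ?ltnS ?leq_pmull //.
by rewrite -big_split; apply: eq_bigr => p _; rewrite lognM.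
Qed.

Lemma Omega1 : Omega 1 = 0%N.
Proof. by rewrite /Omega big1 // => p _; rewrite logn1. Qed.

Lemma Omega_prime p : prime p -> Omega p = 1%N.
Proof.
move=> pp; rewrite /Omega (bigD1 ord_max) //= logn_prime // eqxx big1 // => q.
by rewrite logn_prime // -val_eqE /= => /negPf ->.
Qed.

Lemma Omega_gt0 m : (1 < m)%N -> (0 < Omega m)%N.
Proof.
move=> m1; have pm : (pdiv m < m.+1)%N by rewrite ltnS pdiv_leq // ltnW.
rewrite /Omega (bigD1 (Ordinal pm)) //= addn_gt0 logn_gt0 mem_primes.
by rewrite pdiv_prime // (ltnW m1) pdiv_dvd.
Qed.

Lemma Omega_prod (ps : seq nat) : all prime ps -> Omega (\prod_(p <- ps) p) = size ps.
Proof.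
elim: ps => [|p ps IHps] /=; first by rewrite big_nil Omega1.
move=> /andP[pp pps]; rewrite big_cons OmegaM ?(prime_gt0 pp) ?IHps ?Omega_prime //.
rewrite big_seq; apply: (big_ind (fun x => 0 < x)%N) => // [x y x0 y0|q].
  by rewrite muln_gt0 x0.
by move=> /(allP pps)/prime_gt0.
Qed.

Lemma Omega_exp m k : (0 < m)%N -> Omega (m ^ k) = (k * Omega m)%N.
Proof.
by move=> m0; elim: k => [|k IHk]; rewrite ?Omega1 // expnS OmegaM ?expn_gt0 ?m0 // IHk.
Qed.

(** Along a strict chain of subgroups the order is multiplied each time by an
    index larger than [1]. *)
Lemma depth_le_Omega (Q : finGroupType) : (depth Q <= (Omega #|Q|).+1)%N.
Proof.
have sub (H K : {group Q}) : H \subset K -> #|K| = (#|H| * #|K : H|)%N.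
  by move=> HK; rewrite Lagrange.
have step (H K : {group Q}) : H \proper K -> (Omega #|H| < Omega #|K|)%N.
  move=> HK; rewrite (sub _ _ (proper_sub HK)) OmegaM ?cardG_gt0 ?indexg_gt0 //.
  by rewrite -addn1 leq_add2l Omega_gt0 // indexg_gt1 (proper_subn HK).
have chain (s : seq {group Q}) (H : {group Q}) :
    path (fun H K : {group Q} => K \proper H) H s -> (size s <= Omega #|H|)%N.
  elim: s H => //= K s IHs H /andP[KH /IHs sK].
  exact: leq_ltn_trans (step _ _ KH).
apply/bigmax_leqP => n /existsP[[s /= /eqP <-]].
case: s => //= H s /chain sH; rewrite ltnS (leq_trans sH) //.
rewrite -[X in (_ <= Omega X)%N](cardsT Q) (sub H [set: Q]%G) ?finset.subsetT //.
by rewrite OmegaM ?cardG_gt0 ?indexg_gt0 // leq_addr.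
Qed.

End Depth.

(** * A supply of primes *)

Section Primes.

(** Euclid's argument for [N := 2 m K! - 1]: its prime factors exceed [K], and they
    cannot all be [1] modulo [2 m], since [N] is [- 1] and [2 m > 2]. *)
Lemma prime_not_1_mod (m K : nat) : (1 < m)%N ->
  exists l, [/\ prime l, (K < l)%N & ~~ (l == 1 %[mod 2 * m])].
Proof.
move=> m1; pose N := (2 * m * K`!).-1.
have N1 : (1 < N)%N by have := fact_gt0 K; rewrite /N; nia.
have big_factor q : prime q -> q %| N -> (K < q)%N.
  move=> pq qN; rewrite ltnNge; apply/negP => qK.
  have qfact : q %| K`! by apply: dvdn_fact; rewrite prime_gt0.
  have : q %| N.+1 by rewrite prednK ?dvdn_mull //; have := fact_gt0 K; nia.
  by rewrite -addn1 dvdn_addr // dvdn1 => /eqP q1; rewrite q1 in pq.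
apply: contrapT => no.
have all1 q : prime q -> q %| N -> q = 1 %[mod 2 * m].
  move=> pq qN; apply/eqP/negPn/negP => ne; apply: no; exists q.
  by split=> //; exact: big_factor.
have prod1 d : d %| N -> (0 < d)%N -> d = 1 %[mod 2 * m].
  elim/ltn_ind: d => d IHd dN d0; have [d1|d1] := leqP d 1.
    by have -> : d = 1%N by apply/eqP; rewrite eqn_leq d1.
  have pd := pdiv_prime d1; have pdd := pdiv_dvd d.
  rewrite -(divnK pdd) -modnMm (all1 _ pd (dvdn_trans pdd dN)).
  have dd : (d %/ pdiv d) %| d.
    by apply/dvdnP; exists (pdiv d); rewrite mulnC divnK.
  have lt : (d %/ pdiv d < d)%N by rewrite ltn_Pdiv ?prime_gt1.
  have gt0 : (0 < d %/ pdiv d)%N by rewrite divn_gt0 ?prime_gt0 // dvdn_leq.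
  by rewrite (IHd _ lt (dvdn_trans dd dN) gt0) modnMm muln1.
have : N.+1 = 2 %[mod 2 * m].
  by rewrite -addn1 -modnDm (prod1 N) // ?modnDm // ltnW.
rewrite prednK; last by have := fact_gt0 K; nia.
by rewrite modnMr modn_small //; lia.
Qed.

End Primes.

(** Three primes for each [m], so that one of them avoids both [p] and [q]. *)
Lemma prime_supply (M K : nat) : exists ps : seq nat,
  [/\ size ps = (3 * M)%N, all prime ps, all (fun l => K < l)%N ps
    & forall m p q, (1 < m <= M.+1)%N ->
      exists l, [/\ l \in ps, l != p, l != q & ~~ (l == 1 %[mod 2 * m])]].
Proof.
elim: M => [|M [ps [ps_size ps_prime ps_big psP]]].
  by exists [::]; split=> // m p q; lia.
have m1 : (1 < M.+2)%N by [].
have [a [a_prime Ka a1]] := prime_not_1_mod K m1.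
have [b [b_prime ab b1]] := prime_not_1_mod a m1.
have [c [c_prime bc c1]] := prime_not_1_mod b m1.
exists [:: a, b, c & ps]; split=> /=.
- by rewrite ps_size mulnS.
- by rewrite a_prime b_prime c_prime.
- by rewrite ps_big Ka (ltn_trans Ka ab) (ltn_trans (ltn_trans Ka ab) bc).
move=> m p q /andP[m_gt1 mM]; have [mM'|] := leqP m M.+1.
  have [l [lps lp lq lm]] := psP m p q (introT andP (conj m_gt1 mM')).
  by exists l; split=> //; rewrite !inE lps !orbT.
move=> Mm; have -> : m = M.+2 by apply/eqP; rewrite eqn_leq mM.
have [/andP[ap aq]|] := boolP ((a != p) && (a != q)).
  by exists a; rewrite !inE eqxx.
have [/andP[bp bq] _|] := boolP ((b != p) && (b != q)).
  by exists b; rewrite !inE eqxx orbT.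
rewrite !negb_and !negbK => ab_pq bb_pq.
exists c; rewrite !inE eqxx !orbT; split=> //.
  by apply/eqP => cp; move: ab_pq bb_pq Ka ab bc; rewrite cp; clear; lia.
by apply/eqP => cq; move: ab_pq bb_pq Ka ab bc; rewrite cq; clear; lia.
Qed.

Lemma expn_gcd_1 (l j a b : nat) : (0 < a)%N -> j ^ a = 1%N %[mod l] ->
  j ^ b = 1 %[mod l] -> j ^ gcdn a b = 1 %[mod l].
Proof.
move=> a0 ja jb; have [u v uv _] := egcdnP b a0.
have ju : j ^ (u * a) = 1 %[mod l] by rewrite mulnC expnM -modnXm ja modnXm exp1n.
have jv : j ^ (v * b) = 1 %[mod l] by rewrite mulnC expnM -modnXm jb modnXm exp1n.
by rewrite -ju uv expnD -modnMm jv modnMm mul1n.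
Qed.

(** The order of [j] divides [q ^ k], [M] and [l - 1]. It is [1] if [q] does not
    divide [M]. Otherwise [2 q] does not divide [l - 1], so the order is [1] for
    odd [q] and at most [2] for [q = 2]. *)
Lemma root_of_unity_sign (l q k M j : nat) :
    prime l -> odd l -> prime q -> (0 < M)%N ->
    ((q <= M)%N -> ~~ (l == 1 %[mod 2 * q])) ->
    j ^ (q ^ k) = 1 %[mod l] -> j ^ M = 1 %[mod l] ->
  j ^ 2 = 1 %[mod l].
Proof.
move=> l_prime l_odd q_prime M0 lq jq jM.
have q0 : (0 < q ^ k)%N by rewrite expn_gt0 prime_gt0.
have of_dvd2 (g : nat) : g %| 2 -> j ^ g = 1 %[mod l] -> j ^ 2 = 1 %[mod l].
  by move=> /dvdnP[h ->] jg; rewrite mulnC expnM -modnXm jg modnXm exp1n.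
have [qM|qM] := boolP (q %| M); last first.
  apply: (of_dvd2 _ _ (expn_gcd_1 q0 jq jM)).
  have /eqP -> : coprime (q ^ k) M by rewrite coprimeXl // prime_coprime.
  exact: dvd1n.
have lj : coprime l j.
  rewrite prime_coprime //; apply/negP => lj.
  have : j ^ M = 0 %[mod l] by rewrite -(prednK M0) expnS -modnMml (eqP lj) mul0n.
  by rewrite jM mod0n modn_small // prime_gt1.
have jl : j ^ l.-1 = 1 %[mod l].
  by rewrite -totient_prime //; apply: Euler_exp_totient; rewrite coprime_sym.
have lq' := lq (dvdn_leq M0 qM).
have l1 := prime_gt1 l_prime.
have not2q : ~~ (2 * q %| l.-1).
  by apply: contra lq'; rewrite eqn_mod_dvd ?subn1 // ltnW.
apply: (of_dvd2 _ _ (expn_gcd_1 q0 jq jl)).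
have /(dvdn_pfactor _ _ q_prime)[e ek gE] := dvdn_gcdl (q ^ k) l.-1.
have qe : q ^ e %| l.-1 by rewrite -gE dvdn_gcdr.
rewrite gE; case: e qe {ek gE} => [|e] qe; first by rewrite dvd1n.
have even_l : 2 %| l.-1 by rewrite dvdn2 -subn1 oddB ?l_odd // ltnW.
case: (eqVneq q 2) => [q2|q2].
  case: e qe => [|e] qe; first by rewrite q2.
  by case/negP: not2q; apply: dvdn_trans qe; rewrite q2 !expnS mulnA dvdn_mulr.
case/negP: not2q; rewrite Gauss_dvd ?even_l.
  by apply: dvdn_trans qe; rewrite expnS dvdn_mulr.
by rewrite prime_coprime // dvdn_prime2 // eq_sym.
Qed.

(** * Elements of order [l] in a Dress group *)

Section DressSubgroups.
Variables (Q : finGroupType) (D L P H : {group Q}) (p q l M : nat).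
Hypotheses (p_prime : prime p) (q_prime : prime q) (l_prime : prime l).
Hypotheses (lp : l != p) (lq : l != q) (M0 : (0 < M)%N) (l_odd : odd l).
Hypothesis l_q : (q <= M)%N -> ~~ (l == 1 %[mod 2 * q]).
Hypotheses (PH : P <| H) (HD : H <| D) (p_P : p.-group P).
Hypotheses (cyc : cyclic (H / P)) (q_DH : q.-group (D / H)).
Hypotheses (LD : L <| D) (L_exp : forall x, x \in L -> x ^+ l = 1).
Hypothesis DM : forall d x, d \in D -> x \in L -> x ^ (d ^+ M) = x.

Lemma torsion_pgroup : l.-group L.
Proof.
apply/pgroupP => r r_prime /(Cauchy r_prime)[x xL xr].
have : #[x] %| l by rewrite order_dvdn L_exp.
by rewrite xr dvdn_prime2.
Qed.

Lemma torsion_sub_H : L \subset H.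
Proof.
have LN : L \subset 'N(H) := fintype.subset_trans (normal_sub LD) (normal_norm HD).
rewrite -quotient_sub1 //.
have l_LH : l.-group (L / H) := quotient_pgroup H torsion_pgroup.
have q_LH : q.-group (L / H) := pgroupS (quotientS H (normal_sub LD)) q_DH.
have : coprime #|L / H| #|L / H|.
  apply: pnat_coprime l_LH _; apply: sub_in_pnat q_LH => r _.
  by rewrite !inE => /eqP ->; rewrite eq_sym.
by move/coprime_TIg; rewrite finset.setIid => ->.
Qed.

Lemma torsion_TI_P : L :&: P = 1.
Proof.
apply: coprime_TIg; apply: pnat_coprime torsion_pgroup _.
by apply: sub_in_pnat p_P => r _; rewrite !inE => /eqP ->; rewrite eq_sym.
Qed.

Lemma torsion_cyclic : cyclic L.
Proof.
have LN : L \subset 'N(P) := fintype.subset_trans torsion_sub_H (normal_norm PH).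
rewrite (isog_cyclic (quotient_isog LN _)); last by rewrite finset.setIC torsion_TI_P.
exact: cyclicS (quotientS P torsion_sub_H) cyc.
Qed.

(** A commutator of [H] and [L] lies in [L], which is normal, and in [P], since
    [H / P] is abelian. *)
Lemma H_centralises_torsion : H \subset 'C(L).
Proof.
have HL : H \subset 'N(L) := fintype.subset_trans (normal_sub HD) (normal_norm LD).
have HP := normal_norm PH.
have LN : L \subset 'N(P) := fintype.subset_trans torsion_sub_H HP.
apply/commG1P/trivgP; rewrite -torsion_TI_P finset.subsetI commg_subr HL /=.
rewrite -quotient_cents2 //; apply: fintype.subset_trans (cyclic_abelian cyc) (centS _).
exact: quotientS torsion_sub_H.
Qed.

(** Conjugation by [d] is the power map of some exponent [j]. A power of [d] of
    exponent [q ^ k] lies in [H] and centralises [L], and so does [d ^+ M]; this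
    makes [j] a square root of [1] modulo [l]. *)
Lemma dress_signs x d : x \in L -> x != 1 -> d \in D -> x ^ d = x \/ x ^ d = x^-1.
Proof.
move=> xL x1 dD.
have ord y : y \in L -> y != 1 -> #[y] = l.
  move=> yL y1; apply/eqP; have : #[y] %| l by rewrite order_dvdn L_exp.
  by case/primeP: l_prime => _ H' /H'; rewrite order_eq1 (negPf y1).
have L_x : (L : {set Q}) = <[x]>.
  have /cyclicP[y Ly] := torsion_cyclic.
  have yL : y \in L by rewrite Ly cycle_id.
  have y1 : y != 1.
    by apply: contraTneq xL => y1; rewrite Ly y1 cycle1 inE.
  apply/eqP; rewrite eq_sym eqEcard cycle_subG xL Ly /=.
  by rewrite -!orderE (ord x xL x1) (ord y yL y1).
have powers m : exists j, x ^ (d ^+ m) = x ^+ j.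
  have : x ^ (d ^+ m) \in L.
    by rewrite memJ_norm // (fintype.subsetP (normal_norm LD)) // groupX.
  by rewrite L_x => /cycleP[j ->]; exists j.
have [j xj] := powers 1%N; rewrite expg1 in xj.
have xjm m : x ^ (d ^+ m) = x ^+ (j ^ m)%N.
  elim: m => [|m IHm]; first by rewrite expg0 conjg1.
  by rewrite expgS conjgM xj conjXg IHm -expgM expnSr.
have mod_l a : x ^+ a = x -> a = 1%N %[mod l].
  move=> xa; apply/eqP; rewrite -(ord x xL x1) -eq_expg_mod_order.
  by rewrite xa expg1.
have [k qk] : exists k, d ^+ (q ^ k)%N \in H.
  have dN : d \in 'N(H) by apply: (fintype.subsetP (normal_norm HD)).
  have dDH : coset H d \in D / H by apply: mem_quotient.
  have [k kE] := p_natP (mem_p_elt q_DH dDH).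
  by exists k; apply: coset_idr; rewrite ?groupX // morphX // -kE expg_order.
have jq : (j ^ (q ^ k))%N = 1%N %[mod l].
  apply: mod_l; rewrite -xjm; apply/conjg_fixP/commgP/commute_sym.
  exact: (centsP H_centralises_torsion).
have jM : (j ^ M)%N = 1%N %[mod l] by apply: mod_l; rewrite -xjm DM.
have := root_of_unity_sign l_prime l_odd q_prime M0 l_q jq jM.
rewrite xj; case: j {xj xjm jq jM} => [|j].
  by rewrite exp0n // mod0n modn_small // prime_gt1.
move/eqP; rewrite eqn_mod_dvd ?expn_gt0 // -[X in (_ - X)%N](exp1n 2) subn_sqr.
rewrite Euclid_dvdM // subn1 addn1 /= => /orP[lj|lj]; [left|right].
  by rewrite expgS; have /eqP -> : x ^+ j == 1; rewrite ?mulg1 // -order_dvdn ord.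
by apply: (@mulIg _ x); apply/eqP; rewrite -expgSr mulVg -order_dvdn ord.
Qed.

End DressSubgroups.

(** * Lines preserved by the group *)

Section DivisibleVectors.
Local Open Scope ring_scope.
Variables (n l : nat).

Definition divides_vector (u : 'rV[int]_n) : Prop := exists w, u = w *+ l.

Lemma divides_vectorB u v :
  divides_vector u -> divides_vector v -> divides_vector (u - v).
Proof. by move=> [a ->] [b ->]; exists (a - b); rewrite mulrnBl. Qed.

Lemma divides_vector0 : divides_vector 0.
Proof. by exists 0; rewrite mul0rn. Qed.

Lemma divides_vectorN u : divides_vector u -> divides_vector (- u).
Proof.
by rewrite -[- u]add0r => du; exact: divides_vectorB divides_vector0 du.
Qed.

Lemma divides_vectorD u v :
  divides_vector u -> divides_vector v -> divides_vector (u + v).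
Proof. by move=> du dv; rewrite -[v]opprK; apply/divides_vectorB/divides_vectorN. Qed.

Lemma divides_vectorZ k u : divides_vector u -> divides_vector (k *: u).
Proof. by move=> [a ->]; exists (k *: a); rewrite scalerMnr. Qed.

Lemma divides_vector_sum (I : finType) (f : I -> 'rV[int]_n) :
  (forall i, divides_vector (f i)) -> divides_vector (\sum_i f i).
Proof.
move=> df; apply: (big_ind divides_vector) => //; first exact: divides_vector0.
exact: divides_vectorD.
Qed.

Lemma divides_vector_cancel m u : coprime l m ->
  divides_vector (u *+ m) -> divides_vector u.
Proof.
case: m => [|m]; first by rewrite /coprime gcdn0 => /eqP l1; exists u; rewrite l1.
move=> lm du; have [a b ab _] := egcdnP l (ltn0Sn m).
rewrite gcdnC (eqP lm) in ab.
have -> : u = (a%:Z *: (u *+ m.+1)) - (u *+ b) *+ l.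
  rewrite -[a%:Z]natz scaler_nat -!mulrnA (mulnC m.+1) ab mulrnDr.
  by rewrite addrAC subrr add0r.
by apply: divides_vectorB; [exact: divides_vectorZ|exists (u *+ b)].
Qed.

End DivisibleVectors.

Section InvariantLine.
Variables (G : groupType) (F : finGroupType) (pr : {multiplicative G -> F}).
Variables (n : nat) (phi : 'rV[int]_n -> G).
Hypothesis phiD : forall u v, phi (u + v)%R = phi u * phi v.
Hypothesis phi_inj : injective phi.
Hypothesis pr_ker : forall g, pr g = 1 <-> exists u, phi u = g.

Lemma act_exists : exists a : G -> 'rV[int]_n -> 'rV[int]_n,
  forall g u, phi (a g u) = g * phi u * g^-1.
Proof.
have /choice[a aP] : forall p : G * 'rV[int]_n, exists v,
    phi v = p.1 * phi p.2 * p.1^-1.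
  move=> [g u] /=; apply/pr_ker; rewrite !gmulfM homV.
  by rewrite (pr_phi pr_ker) mulg1 mulgV.
by exists (fun g u => a (g, u)) => g u; rewrite aP.
Qed.

Variable act : G -> 'rV[int]_n -> 'rV[int]_n.
Hypothesis actP : forall g u, phi (act g u) = g * phi u * g^-1.

Lemma act_is_zmod_morphism g : zmod_morphism (act g).
Proof.
move=> u v; apply: phi_inj; rewrite phiD (phiN phiD) !actP phiD (phiN phiD).
by rewrite !invgM invgK !mulgA mulgKV.
Qed.

HB.instance Definition _ g :=
  GRing.isZmodMorphism.Build _ _ (act g) (act_is_zmod_morphism g).

Lemma scale_int (k : int) (u : 'rV[int]_n) : (k *: u = u *~ k)%R.
Proof. by rewrite -[in LHS](intz k) scaler_int. Qed.

Lemma actZ g (k : int) u : act g (k *: u)%R = (k *: act g u)%R.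
Proof. by rewrite !scale_int raddfMz. Qed.

Lemma actM g h u : act (g * h) u = act g (act h u).
Proof. by apply: phi_inj; rewrite !actP invgM !mulgA. Qed.

Lemma act_phi u v : act (phi u) v = v.
Proof. by apply: phi_inj; rewrite actP -!phiD addrC phiD mulgK. Qed.

Lemma act_pr g h u : pr g = pr h -> act g u = act h u.
Proof. by move=> /(same_coset pr_ker)[v ->]; rewrite actM act_phi. Qed.

Lemma act_divides l g u : divides_vector l u -> divides_vector l (act g u).
Proof. by move=> [w ->]; exists (act g w); rewrite raddfMn. Qed.

Lemma line_normal (v : 'rV[int]_n) : v <> 0%R ->
    (forall g, act g v = v \/ act g v = (- v)%R) ->
  exists C : set G, normal_subgroup C /\ infinite_cyclic C.
Proof.
move=> v0 v_line; pose C := range (fun k : int => phi (k *: v)%R).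
have C_sub : subgroup C.
  split; first by exists 0%R; rewrite // scale0r (phi0 phiD).
  move=> _ _ [a _ <-] [b _ <-]; exists (a - b)%R => //.
  by rewrite scalerBl phiD (phiN phiD).
have v_inj (a b : int) : (a *: v = b *: v)%R -> a = b.
  move=> ab; have [i vi] : exists i, v ord0 i != 0%R.
    apply: contrapT => no; apply: v0; apply/rowP => i; rewrite mxE.
    by apply/eqP/negPn/negP => ne; apply: no; exists i.
  have /rowP/(_ i) := ab; rewrite !mxE => /eqP.
  by rewrite -subr_eq0 -mulrBl mulf_eq0 (negPf vi) orbF subr_eq0 => /eqP.
exists C; split.
  split=> // g _ [k _ <-].
  have conjE : phi (k *: v)%R ^ g = phi (k *: act g^-1 v)%R.
    by rewrite -actZ actP invgK /conjg mulgA.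
  rewrite conjE; case: (v_line g^-1) => ->; first by exists k.
  by exists (- k)%R; rewrite // scalerN scaleNr.
split.
  exists (phi v); apply/seteqP; split=> [_ [k _ <-] H [H1 HM] vH|g].
    have Hv : H (phi v) by exact: vH.
    have HV x : H x -> H x^-1 by move=> Hx; rewrite -[_^-1]mul1g; exact: HM.
    have Hn (m : nat) : H (phi (m%:Z *: v)%R).
      elim: m => [|m IHm]; first by rewrite scale0r (phi0 phiD).
      rewrite (_ : m.+1%:Z = m%:Z + 1)%R; last by lia.
      rewrite scalerDl scale1r phiD -[phi v]invgK.
      by apply: (HM) => //; exact: HV.
    case: k => k; first exact: Hn.
    by rewrite NegzE scaleNr (phiN phiD); exact: HV.
  by apply=> // _ ->; exists 1%R; rewrite // scale1r.
apply/infiniteP.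
pose f (m : nat) := phi (m%:Z *: v)%R.
have f_inj : {in setT &, injective f}.
  by move=> a b _ _ /phi_inj/v_inj [].
have /card_eqPle[_ /card_le_trans] := inj_card_eq f_inj; apply.
by apply: subset_card_le => _ [m _ <-]; exists (Posz m).
Qed.

Section Signs.
Variables (l : nat) (D : set G) (w : 'rV[int]_n).
Hypotheses (l_prime : prime l) (l_odd : odd l) (lF : ~~ (l %| #|F|)).
Hypothesis prD : pr @` D = [set: F].
Hypothesis w_sign : forall d, D d ->
  divides_vector l (act d w - w)%R \/ divides_vector l (act d w + w)%R.
Hypothesis w_ndiv : ~ divides_vector l w.

(** The signs define a character of [F], since [l] is odd and [w] is not divisible
    by [l]. The sum of the translates of [w], weighted by the signs, spans a line
    preserved by [G]; it is congruent to [#|F| w] modulo [l], so it is not [0]. *)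
Lemma signs_give_line : exists C : set G, normal_subgroup C /\ infinite_cyclic C.
Proof.
have /choice[sec secK] : forall f : F, exists g, pr g = f.
  by move=> f; have [g _ <-] : (pr @` D) f by [rewrite prD]; exists g.
pose af f u := act (sec f) u.
have afM f g u : af (f * g) u = af f (af g u).
  by rewrite /af -actM; apply: act_pr; rewrite gmulfM !secK.
have af_act g u : act g u = af (pr g) u by apply: act_pr; rewrite secK.
have /choice[eps epsP] : forall f, exists b : bool,
    divides_vector l (af f w - (-1) ^+ b *: w)%R.
  move=> f; have [d Dd df] : (pr @` D) f by rewrite prD.
  have := w_sign Dd; rewrite af_act df => -[dw|dw]; [exists false|exists true].
    by rewrite expr0 scale1r.
  by rewrite expr1 scaleN1r opprK.
have w_inj (a b : bool) : divides_vector l ((-1) ^+ a *: w - (-1) ^+ b *: w)%R -> a = b.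
  have two : ~ divides_vector l (w *+ 2)%R.
    by apply: contra_not w_ndiv; apply: divides_vector_cancel; rewrite coprimen2.
  case: a; case: b => //; rewrite expr0 expr1 scaleN1r scale1r => dw; case: two.
    by rewrite mulr2n -[(w + w)%R]opprK opprD; exact: divides_vectorN.
  by rewrite mulr2n -[X in (w + X)%R]opprK.
have epsM f g : eps (f * g) = eps f (+) eps g.
  apply: w_inj.
  have d1 := epsP (f * g); rewrite afM in d1.
  have d2 : divides_vector l (af f (af g w) - (-1) ^+ eps g *: af f w)%R.
    by rewrite -actZ -raddfB; exact: act_divides.
  have d3 := divides_vectorZ ((-1) ^+ eps g) (epsP f).
  have := divides_vectorB (divides_vectorD d2 d3) d1.
  rewrite scalerBr scalerA -signr_addb addbC.
  by rewrite subrKA opprB addrC subrKA.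
pose v := (\sum_f (-1) ^+ eps f *: af f w)%R.
have act_v g : act g v = ((-1) ^+ eps (pr g) *: v)%R.
  rewrite /v raddf_sum scaler_sumr [RHS](reindex_inj (mulgI (pr g))) /=.
  apply: eq_bigr => f _; rewrite actZ af_act -afM scalerA -signr_addb.
  by rewrite epsM addbA addbb.
apply: (@line_normal v) => [v0|g]; last first.
  rewrite act_v; case: (eps _); [right|left]; first by rewrite expr1 scaleN1r.
  by rewrite expr0 scale1r.
apply: w_ndiv; apply: (@divides_vector_cancel _ _ #|F|).
  by rewrite prime_coprime.
suff : divides_vector l (v - w *+ #|F|)%R.
  by rewrite v0 sub0r => /divides_vectorN; rewrite opprK.
have -> : (w *+ #|F| = \sum_(f : F) w)%R by rewrite sumr_const.
rewrite -sumrB.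
apply: divides_vector_sum => f; have := divides_vectorZ ((-1) ^+ eps f) (epsP f).
by rewrite scalerBr scalerA -signr_addb addbb expr0 scale1r.
Qed.

End Signs.
End InvariantLine.

(** * Dress subgroups of the quotients of a lattice extension *)

Lemma mulrn_vector_inj n m (u v : 'rV[int]_n) :
  (0 < m)%N -> (u *+ m = v *+ m)%R -> u = v.
Proof.
move=> m0 /rowP uv; apply/rowP => i; have := uv i; rewrite !mulmxnE => /eqP.
by rewrite -subr_eq0 -mulrnBl mulrn_eq0 -[m == _]negbK -lt0n m0 subr_eq0 => /eqP.
Qed.

Section FiniteQuotients.
Variables (G : groupType) (F : finGroupType) (pr : {multiplicative G -> F}).
Variables (n : nat) (phi : 'rV[int]_n -> G).
Hypothesis phiD : forall u v, phi (u + v)%R = phi u * phi v.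
Hypothesis phi_inj : injective phi.
Hypothesis pr_ker : forall g, pr g = 1 <-> exists u, phi u = g.
Variables (sec : F -> G) (tau : G -> 'rV[int]_n) (act : G -> 'rV[int]_n -> 'rV[int]_n).
Hypothesis secK : forall f, pr (sec f) = f.
Hypothesis tauE : forall g, g = phi (tau g) * sec (pr g).
Hypothesis actP : forall g u, phi (act g u) = g * phi u * g^-1.

Lemma act_natmul g u k : act g (u *+ k)%R = (act g u *+ k)%R.
Proof.
have A_add := act_is_zmod_morphism phiD phi_inj actP g.
pose A : {additive 'rV[int]_n -> 'rV[int]_n} := HB.pack (act g)
  (GRing.isZmodMorphism.Build _ _ (act g) A_add).
by rewrite -[act g]/(A : _ -> _) raddfMn.
Qed.

(** An element [phi u * sec f] is sent to [f] and the residues modulo [s] of the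
    coordinates of [u]. *)
Lemma lattice_quotient s : (0 < s)%N ->
  exists (Q : finGroupType) (p : {multiplicative G -> Q}),
    [/\ range p = [set: Q], #|Q| = (#|F| * s ^ n)%N
      & forall g, p g = 1 <-> exists u, g = phi (u *+ s)%R].
Proof.
case: s => // s _.
pose r (z : int) : 'I_s.+1 := inord `|(z %% Posz s.+1)%Z|%N.
have rK (k : 'I_s.+1) : r (Posz k) = k.
  by rewrite /r modz_nat absz_nat modn_small // inord_val.
have rE (z y : int) : r z = r y <-> (Posz s.+1 %| (z - y)%R)%Z.
  rewrite -eqz_mod_dvd; split=> [|/eqP E]; last by rewrite /r E.
  have bound x : (`|(x %% Posz s.+1)%Z|%N < s.+1)%N.
    by rewrite -ltz_nat gez0_abs ?modz_ge0 // ltz_pmod.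
  rewrite /r => /(congr1 val); rewrite /= !inordK // => E.
  by apply/eqP; rewrite -[LHS]gez0_abs ?modz_ge0 // -[RHS]gez0_abs ?modz_ge0 // E.
pose c g : F * {ffun 'I_n -> 'I_s.+1} := (pr g, [ffun i => r (tau g ord0 i)]).
have c_surj t : exists g, c g = t.
  case: t => f h; pose u : 'rV[int]_n := (\row_i Posz (h i))%R.
  exists (phi (u - tau (sec f))%R * sec f).
  rewrite /c gmulfM (pr_phi pr_ker) mul1g secK.
  congr (_, _); apply/ffunP => i; rewrite ffunE (tau_phi phiD phi_inj pr_ker tauE).
  by rewrite subrK mxE rK.
have cE x y : c x = c y <-> exists w, y = phi (w *+ s.+1)%R * x.
  split=> [[xy /ffunP E]|[w ->]]; last first.
    rewrite /c gmulfM (pr_phi pr_ker) mul1g; congr (_, _); apply/ffunP => i.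
    rewrite !ffunE (tau_phi phiD phi_inj pr_ker tauE) !mxE mulmxnE.
    by apply/rE; rewrite opprD addrCA subrr addr0 -mulNrn -mulr_natr natz dvdz_mull.
  have /choice[w wE] i : exists w, (tau y ord0 i - tau x ord0 i = w * Posz s.+1)%R.
    by apply/dvdzP/rE; have := E i; rewrite !ffunE.
  exists (\row_i w i)%R; rewrite {1}(tauE y) [X in _ = _ * X](tauE x) mulgA -phiD -xy.
  congr (phi _ * _); apply/rowP => i; rewrite !mxE mulmxnE mxE.
  by rewrite -mulr_natr natz -wE subrK.
have cM x x' y y' : c x = c x' -> c y = c y' -> c (x * y) = c (x' * y').
  move=> /cE[a ->] /cE[b ->]; apply/cE; exists (a + act x b)%R.
  rewrite mulrnDl phiD -act_natmul actP.
  by rewrite -!mulgA mulKg.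
have [Q [p [Q_card p_onto pE]]] := finite_quotient c_surj cM.
exists Q, p; split=> //.
  by rewrite Q_card card_prod card_ffun !card_ord.
move=> g; rewrite -(hom1 p); split=> [/esym/pE/cE[u ->]|[u ->]].
  by exists u; rewrite mulg1.
by apply/esym/pE/cE; exists u; rewrite mulg1.
Qed.

Section DressQuotients.
Variables (s : nat) (Q : finGroupType) (p : {multiplicative G -> Q}).
Hypothesis s_gt0 : (0 < s)%N.
Hypothesis p_onto : range p = [set: Q].
Hypothesis p_ker : forall g, p g = 1 <-> exists u, g = phi (u *+ s)%R.

Lemma quotient_phi_natmul u k : p (phi (u *+ k)%R) = p (phi u) ^+ k.
Proof.
elim: k => [|k IHk]; first by rewrite mulr0n (phi0 phiD) hom1 expg0.
by rewrite mulrS phiD gmulfM IHk expgS.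
Qed.

Definition lattice_torsion (D : {group Q}) (l : nat) : {set Q} :=
  [set x in D | `[< exists u, p (phi u) = x >] && (x ^+ l == 1)]%SET.

Lemma lattice_torsionP (D : {group Q}) l x : reflect
  [/\ x \in D, exists u, p (phi u) = x & x ^+ l = 1] (x \in lattice_torsion D l).
Proof.
rewrite inE; apply: (iffP andP) => [[xD /andP[/asboolP xu /eqP xl]]|[xD xu xl]] //.
by split=> //; apply/andP; split; [exact/asboolP|exact/eqP].
Qed.

Lemma lattice_torsion_group_set (D : {group Q}) l : group_set (lattice_torsion D l).
Proof.
apply/group_setP; split.
  apply/lattice_torsionP; split; rewrite ?group1 ?expg1n //.
  by exists 0%R; rewrite (phi0 phiD) hom1.
move=> x y /lattice_torsionP[xD [u ux] ul] /lattice_torsionP[yD [v vy] vl].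
apply/lattice_torsionP; split; first by rewrite groupM.
  by exists (u + v)%R; rewrite phiD gmulfM ux vy.
rewrite expgMn ?ul ?vl ?mulg1 //.
by rewrite /commute -ux -vy -!gmulfM -!phiD addrC.
Qed.

Canonical lattice_torsion_group (D : {group Q}) l :=
  Group (lattice_torsion_group_set D l).

Lemma lattice_torsion_normal (D : {group Q}) l : lattice_torsion_group D l <| D.
Proof.
rewrite /normal; apply/andP; split.
  by apply/fintype.subsetP => x /lattice_torsionP[].
apply/fintype.subsetP => d dD; rewrite inE.
apply/fintype.subsetP => _ /imsetP[x /lattice_torsionP[xD [u ux] ul] ->].
apply/lattice_torsionP; split; first by rewrite groupJ.
  have [g _ gd] : range p d by rewrite p_onto.
  by exists (act g^-1 u); rewrite actP invgK -gd -ux /conjg !gmulfM homV mulgA.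
by rewrite -conjXg ul conj1g.
Qed.

(** If [phi u] maps into [D] and [u] is not divisible by [l], then
    [(s / l) u] maps to an element of order [l] of [D], on which [D] acts by
    signs, and [G] acts by signs on [u] modulo [l]. *)
Lemma dress_lattice_divisible (D : {group Q}) (ps : seq nat) :
    ~ (exists C : set G, normal_subgroup C /\ infinite_cyclic C) ->
    is_dress D -> pr @` [set g | p g \in D] = [set: F] ->
    all prime ps -> all (fun l => #|F| + 1 < l)%N ps ->
    (forall l, l \in ps -> l %| s) ->
    (forall m a b, (1 < m <= #|F|.+1)%N ->
      exists l, [/\ l \in ps, l != a, l != b & ~~ (l == 1 %[mod 2 * m])]) ->
  exists2 l, l \in ps & forall u, p (phi u) \in D -> divides_vector l u.
Proof.
move=> no_line [a [q [a_prime [q_prime [P [H [PH HD a_P cyc q_DH]]]]]]] prD.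
move=> ps_prime ps_big ps_dvd psP.
have F_gt0 : (0 < #|F|)%N by apply/card_gt0P; exists 1.
(* If [q > #|F|], the condition modulo [2 q] is void, and any [m] in range will do. *)
pose m := if (q <= #|F|)%N then q else 2.
have m_range : (1 < m <= #|F|.+1)%N.
  rewrite /m; case: ifP => [qF|_]; last by rewrite /= ltnS.
  by rewrite prime_gt1 /=  ?(leqW qF).
have [l [lps la lq lm]] := psP m a q m_range.
have l_prime := allP ps_prime l lps; have l_big := allP ps_big l lps.
have l_odd : odd l.
  case/even_prime: (l_prime) => [l2|//].
  by move: l_big; rewrite l2 addn1 !ltnS leqNgt F_gt0.
have lF : ~~ (l %| #|F|).
  apply/negP => /(dvdn_leq F_gt0); rewrite leqNgt => /negP; apply.
  by apply: ltn_trans l_big; rewrite addn1.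
have l_q : (q <= #|F|)%N -> ~~ (l == 1 %[mod 2 * q]) by move: lm; rewrite /m; case: ifP.
have /dvdnP[s1 sE] := ps_dvd l lps.
have s1_gt0 : (0 < s1)%N by move: s_gt0; rewrite sE muln_gt0 => /andP[].
exists l => // u uD; apply: contrapT => u_ndiv; apply: no_line.
pose L := lattice_torsion_group D l.
have L_exp x : x \in L -> x ^+ l = 1 by case/lattice_torsionP.
have LD := lattice_torsion_normal D l.
have DM d x : d \in D -> x \in L -> x ^ (d ^+ #|F|) = x.
  move=> dD /lattice_torsionP[_ [v <-] _]; have [g _ gd] : range p d by rewrite p_onto.
  have prg : pr (g ^+ #|F|) = 1.
    have powpr k : pr (g ^+ k) = pr g ^+ k.
      by elim: k => [|k IHk]; rewrite ?hom1 // !expgS gmulfM IHk.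
    by rewrite powpr -cardsT; apply/expg_cardG; rewrite inE.
  have powp k : p (g ^+ k) = d ^+ k.
    by elim: k => [|k IHk]; rewrite ?hom1 // !expgS gmulfM IHk gd.
  rewrite -powp; have /pr_ker[w <-] := prg.
  by rewrite /conjg -!gmulfM -phiD addrC phiD gmulfM mulKg.
have signs x d : x \in L -> x != 1 -> d \in D -> x ^ d = x \/ x ^ d = x^-1.
  by apply: (@dress_signs Q D L P H a q l #|F|).
pose x := p (phi (u *+ s1)%R).
have xL : x \in L.
  apply/lattice_torsionP; split; first by rewrite /x quotient_phi_natmul groupX.
    by exists (u *+ s1)%R.
  by rewrite -quotient_phi_natmul -mulrnA -sE; apply/p_ker; exists u.
have div_of (v : 'rV[int]_n) : p (phi (v *+ s1)%R) = 1 -> divides_vector l v.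
  move=> /p_ker[w /phi_inj]; rewrite sE mulnC mulrnA => E.
  by exists w; apply: mulrn_vector_inj s1_gt0 E.
have x1 : x != 1 by apply/eqP => /div_of.
apply: (@signs_give_line _ _ _ _ _ phiD phi_inj pr_ker _ actP l
  [set g | p g \in D] u) => //.
move=> d /= dD; have pV : p d^-1 \in D by rewrite homV groupV.
have xd : x ^ p d^-1 = p (phi (act d u *+ s1)%R).
  by rewrite -act_natmul actP /conjg homV invgK !gmulfM homV mulgA.
have := signs x (p d^-1) xL x1 pV; rewrite xd => -[E|E]; [left|right]; apply: div_of.
  by rewrite mulrnBl phiD (phiN phiD) gmulfM homV E mulgV.
by rewrite mulrnDl phiD gmulfM E mulVg.
Qed.

End DressQuotients.
End FiniteQuotients.

(** * The theorem *)

Theorem proposition5p4 (R : realType) (Gamma : groupType) (A : set Gamma)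
    (n : nat) (F : finGroupType) (pr : {multiplicative Gamma -> F})
    (A_cryst : crystallographic_with A)
    (A_rank : free_abelian_of_rank A n) (n_ge2 : (2 <= n)%N)
    (pr_onto : range pr = [set: F]) (pr_ker : pr @^-1` [set 1] = A)
    (no_cyclic : ~ exists C : set Gamma, normal_subgroup C /\ infinite_cyclic C)
    (S : set Gamma) (S_gen : finite_symmetric_generating S) :
  dress_farrell_hsiang R S (small_subgroups pr).
Proof.
have [m0 vcd_Gamma m0_gt0] : exists2 m, vcd_eq [set: Gamma] m & (0 < m)%N.
  by case: A_cryst => _ _ A_fin _; apply: (vcd_lattice A_rank) A_fin; exact: ltnW.
have small H : subgroup H -> finite_set H -> small_subgroups pr H.
  move=> H_sub H_fin; split=> //; left; exists 0%N, m0; split=> //.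
  exact: vcd_finite.
have [phi [phiD phi_inj phi_range]] := A_rank.
have prK g : pr g = 1 <-> exists u, phi u = g.
  split=> [g1|[u <-]].
    have : A g by rewrite -pr_ker.
    by rewrite -phi_range => -[u _ <-]; exists u.
  have : A (phi u) by rewrite -phi_range; exists u.
  by rewrite -pr_ker.
have /choice[sec secK] : forall f : F, exists g, pr g = f.
  by move=> f; have [g _ <-] : range pr f by [rewrite pr_onto]; exists g.
have /choice[tau tauE] : forall g, exists u, g = phi u * sec (pr g).
  move=> g; have /prK[u uE] : pr (g * (sec (pr g))^-1) = 1.
    by rewrite gmulfM homV secK mulgV.
  by exists u; rewrite uE mulgKV.
have [act actP] := act_exists prK.
have [S_fin _ _] := S_gen.
have [C tau_close] := tau_bounded phiD phi_inj prK tauE S_fin.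
split=> //; first exact: small_subgroups_family.
exists (2 * (#|F| * n))%N, (Omega #|F| + n * (3 * #|F|)).+1 => eps eps_gt0.
(* At a scale larger than [K0] the images of neighbours are [eps]-close. *)
pose K0 := Num.bound ((2 * (#|F| * n * C))%:R / eps : R)%R.
have K0P l : (K0 < l)%N -> ((2 * (#|F| * n * C))%:R / l%:R <= eps :> R)%R.
  move=> Kl; have l_gt0 : (0 < l%:R :> R)%R by rewrite ltr0n (leq_ltn_trans _ Kl).
  rewrite ler_pdivrMr // mulrC -ler_pdivrMr //.
  apply: (@le_trans _ _ (K0%:R)%R); last by rewrite ler_nat ltnW.
  by apply/ltW/archi_boundP/divr_ge0 => //; exact: ltW.
have [ps [ps_size ps_prime ps_big psP]] := prime_supply #|F| (K0 + #|F| + 1).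
pose s := (\prod_(l <- ps) l)%N.
have s_dvd l : l \in ps -> l %| s by move=> lps; rewrite /s (big_rem l) //= dvdn_mulr.
have s_gt0 : (0 < s)%N.
  rewrite /s big_seq; apply: (big_ind (fun x => 0 < x)%N) => // [x y x0 y0|l].
    by rewrite muln_gt0 x0.
  by move=> /(allP ps_prime)/prime_gt0.
have [Q [p [p_onto Q_card p_ker]]] :=
  lattice_quotient phiD phi_inj prK secK tauE actP s_gt0.
exists Q, p; split=> //.
  apply: leq_trans (depth_le_Omega Q) _; rewrite ltnS Q_card.
  have F_gt0 : (0 < #|F|)%N by apply/card_gt0P; exists 1.
  by rewrite OmegaM ?expn_gt0 ?s_gt0 // Omega_exp // Omega_prod // ps_size.
move=> D D_dress; pose Db := [set g | p g \in D].
have Db_sub : subgroup Db.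
  split=> [|x y]; rewrite /Db /= ?hom1 ?group1 // gmulfM homV => xD yD.
  by rewrite groupM ?groupV.
have [prD|prD] := pselect (pr @` Db = [set: F]); last first.
  have [E [f [E_dim E_iso f_real f_eq f_close]]] :=
    proper_image_complex S (ltW eps_gt0) Db_sub prD.
  exists E, f; split=> //.
  move=> t /E_dim; move/card_le_trans; apply.
  by apply: subset_card_le => k /=; rewrite !ltnS leqn0 => /eqP ->.
have ps_bigF : all (fun l => #|F| + 1 < l)%N ps.
  apply/allP => l /(allP ps_big); apply: leq_ltn_trans.
  by rewrite -addnA leq_addl.
have [l lps l_div] := dress_lattice_divisible phiD phi_inj prK actP s_gt0
  p_onto p_ker no_cyclic D_dress prD ps_prime ps_bigF s_dvd psP.
have l_big := allP ps_big l lps.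
have l_gt0 : (0 < l)%N by exact: leq_ltn_trans l_big.
apply: (@contracting_complex _ _ _ _ _ phiD phi_inj prK sec secK tau tauE l l_gt0
  R Db S C eps) => //.
by apply: K0P; apply: leq_ltn_trans l_big; rewrite -addnA leq_addr.
Qed.
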